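(* Let $(\mathbf{X}_n)_{n\in\mathbb{Z}_+}$ be an inhomogeneous $d$-type Galton--Watson process with immigration (GWI process) with Bernoulli immigration, with offspring mean matrices $\mathbf{B}_n$ and immigration mean vectors $\mathbf{m}_n$. Let $\mathbf{I}$ be the $d\times d$ identity matrix and suppose that: (B1) $\lim_{n\to\infty}\mathbf{B}_n=\mathbf{I}$; (B2) there is $n_0$ such that $\|\mathbf{B}_n\|\le 1$ and $\mathbf{I}-\mathbf{B}_n$ is invertible for all $n\ge n_0$; (B3) $\lim_{n\to\infty}\|\mathbf{B}_{[j,n]}\|=0$ for any fixed $j$; (B4) $\lim_{n\to\infty}\sum_{j=1}^n(\mathbf{I}-\mathbf{B}_j)\mathbf{B}_{[j,n]}=\mathbf{A}$ for some matrix $\mathbf{A}$; (B5) $\sup_n\sum_{j=1}^n\|(\mathbf{I}-\mathbf{B}_j)\mathbf{B}_{[j,n]}\|<\infty$; (M) $\lim_{n\to\infty}\mathbf{m}_n(\mathbf{I}-\mathbf{B}_n)^{-1}=\boldsymbol{\lambda}$ for some vector $\boldsymbol{\lambda}$. Assume moreover that $$\lim_{n\to\infty}m_2(n)\,\|(\mathbf{I}-\mathbf{B}_n)^{-1}\|=0,\qquad\text{where}\quad m_2(n)=\max_{1\le i,j,l\le d}\frac{\partial^2}{\partial x_j\partial x_l}G_{n,i}(\mathbf{1}).$$ Then $$\mathbf{X}_n\stackrel{\mathcal{D}}{\longrightarrow}\mathrm{Po}(\boldsymbol{\lambda})\qquad(n\to\infty).$$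
   Context: Elements of $\mathbb{R}^d$ are row vectors; $\mathbf{e}_1,\dots,\mathbf{e}_d$ is the standard basis and $\mathbf{1}=(1,\dots,1)$. $\|\cdot\|$ is an arbitrary norm on $\mathbb{R}^d$, and for a real $d\times d$ matrix $\|\mathbf{A}\|=\sup_{\|\mathbf{x}\|\le1}\|\mathbf{x}\mathbf{A}\|$; the statement means that if the hypotheses hold for some such norm then the conclusion holds. Inhomogeneous $d$-type GWI process: $\mathbf{X}_0=\mathbf{0}$ and $\mathbf{X}_n=\sum_{i=1}^d\sum_{j=1}^{X_{n-1,i}}\boldsymbol{\xi}_{n,j,i}+\boldsymbol{\varepsilon}_n$ for $n\in\mathbb{N}=\{1,2,\dots\}$, where $\mathbf{X}_n=(X_{n,1},\dots,X_{n,d})$ and $\{\boldsymbol{\xi}_{n,j,i},\boldsymbol{\varepsilon}_n: n,j\in\mathbb{N},\,1\le i\le d\}$ are independent random vectors with values in $\mathbb{Z}_+^d$ such that for each $n,i$ the vectors $\boldsymbol{\xi}_{n,j,i}$, $j\in\mathbb{N}$, are identically distributed. All offspring and immigration means are finite. $\mathbf{B}_n\in\mathbb{R}_+^{d\times d}$ is the matrix whose $i$-th row is $\mathsf{E}\boldsymbol{\xi}_{n,1,i}$, and $\mathbf{m}_n=\mathsf{E}\boldsymbol{\varepsilon}_n$. $\mathbf{B}_{[j,n]}=\mathbf{B}_{j+1}\mathbf{B}_{j+2}\cdots\mathbf{B}_n$ for $0\le j\le n-1$, and $\mathbf{B}_{[n,n]}=\mathbf{I}$. $G_{n,i}(\mathbf{x})=\mathsf{E}\,\mathbf{x}^{\boldsymbol{\xi}_{n,1,i}}$,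 $\mathbf{x}\in[0,1]^d$, where $\mathbf{x}^{\mathbf{k}}=x_1^{k_1}\cdots x_d^{k_d}$; derivatives at $\mathbf{1}$ are left derivatives. For $\mathbf{p}=(p_1,\dots,p_d)\in[0,1]^d$ with $p_1+\dots+p_d\le1$, $\mathrm{Be}(\mathbf{p})$ is the distribution on $\{\mathbf{0},\mathbf{e}_1,\dots,\mathbf{e}_d\}$ giving mass $p_i$ to $\mathbf{e}_i$ and $1-\sum_ip_i$ to $\mathbf{0}$. ''Bernoulli immigration'' means that $\boldsymbol{\varepsilon}_n$ has law $\mathrm{Be}(\mathbf{m}_n)$ for all $n$. $\mathrm{Po}(\boldsymbol{\mu})=\mathrm{Po}(\mu_1)\times\dots\times\mathrm{Po}(\mu_d)$ for $\boldsymbol{\mu}=(\mu_1,\dots,\mu_d)\in[0,\infty)^d$ (independent Poisson components). $\stackrel{\mathcal{D}}{\longrightarrow}$ is convergence in distribution. *)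

(* Defs.v *)
From HB Require Import structures.
From mathcomp Require Import all_boot all_order all_algebra finmap.
From mathcomp Require Import all_classical all_reals all_analysis.

Set Implicit Arguments.
Unset Strict Implicit.
Unset Printing Implicit Defensive.

Import Order.TTheory GRing.Theory Num.Theory.
Import numFieldNormedType.Exports.

Local Open Scope classical_set_scope.
Local Open Scope ring_scope.

(* Z_+^d is 'rV[nat]_d with the discrete sigma-algebra. *)
HB.instance Definition _ (m n : nat) :=
  @isMeasurable.Build default_measure_display 'M[nat]_(m, n)
    discrete_measurable discrete_measurable0
    discrete_measurableC discrete_measurableU.

Definition is_norm (R : realType) (d : nat) (N : 'rV[R]_d -> R) : Prop :=
  [/\ forall x y, N (x + y) <= N x + N y,
      forall a x, N (a *: x) = `|a| * N x
    & forall x, N x = 0 -> x = 0].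

Definition opnorm (R : realType) (d : nat) (N : 'rV[R]_d -> R)
    (A : 'M[R]_d) : R :=
  sup [set N (x *m A) | x in [set x | N x <= 1]].

(* Independence of the subfamily (Y i), i in D. *)
Definition mutually_independent d (T : measurableType d) (R : realType)
    (P : probability T R) d' (E : measurableType d') (I : choiceType)
    (D : set I) (Y : I -> {RV P >-> E}) : Prop :=
  forall (J : {fset I}) (A : I -> set E), [set` J] `<=` D ->
    (forall i, measurable (A i)) ->
    P (\bigcap_(i in [set` J]) Y i @^-1` A i) =
    (\prod_(i <- J) P (Y i @^-1` A i))%E.

Section product_law.
Local Open Scope ereal_scope.
Context {R : realType} (d : nat) (mu : 'I_d -> probability nat R).

(* The product measure mu_1 x ... x mu_d on Z_+^d, given by its point masses. *)
Definition product_law : set 'rV[nat]_d -> \bar R :=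
  fun A => \esum_(k in A) \prod_(i < d) mu i [set k ord0 i].

Let mass_ge0 (k : 'rV[nat]_d) : 0 <= \prod_(i < d) mu i [set k ord0 i].
Proof. by apply: prode_ge0 => i _; exact: measure_ge0. Qed.

Let product_law0 : product_law set0 = 0.
Proof. by rewrite /product_law esum_set0. Qed.

Let product_law_ge0 A : 0 <= product_law A.
Proof. by apply: esum_ge0 => k _; exact: mass_ge0. Qed.

Let product_law_sigma_additive : semi_sigma_additive product_law.
Proof.
move=> F mF tF mUF; apply: cvg_toP.
  apply: ereal_nondecreasing_is_cvgn => a b ab.
  by apply: lee_sum_nneg_natr => // n _ _; exact: product_law_ge0.
by rewrite /product_law nneseries_sum_bigcup.
Qed.

HB.instance Definition _ := isMeasure.Build _ _ _ product_law
  product_law0 product_law_ge0 product_law_sigma_additive.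

End product_law.

Lemma esumZl (R : realType) (I : choiceType) (D : set I) (r : R)
    (a : I -> \bar R) : 0 <= r -> (forall i, 0 <= a i)%E ->
  (\esum_(i in D) (r%:E * a i) = r%:E * \esum_(i in D) a i)%E.
Proof.
move=> r0 a0; rewrite /esum -ereal_supZl//; last first.
  apply/set0P; exists 0%E; exists set0; rewrite ?fsbig_set0//.
  by split; [exact: finite_set0|exact: sub0set].
rewrite image_comp; congr ereal_sup; apply: eq_imagel => A [finA _] /=.
by rewrite ge0_mule_fsumr.
Qed.

Lemma esum_rV_prod1 (R : realType) d (mu : 'I_d -> probability nat R) :
  (\esum_(k in [set: 'rV[nat]_d]) \prod_(i < d) mu i [set k ord0 i] = 1)%E.
Proof.
elim: d mu => [|d IH] mu.
  rewrite (_ : [set: 'rV[nat]_0] = [set 0]); last first.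
    by apply/seteqP; split => // x _ /=; apply/rowP => -[].
  by rewrite esum_set1 ?big_ord0// ?lee01.
pose e (z : nat * 'rV[nat]_d) : 'rV[nat]_d.+1 :=
  \row_j (if unlift ord0 j is Some i then z.2 ord0 i else z.1).
have e0 z : e z ord0 ord0 = z.1 by rewrite mxE unlift_none.
have eS z i : e z ord0 (lift ord0 i) = z.2 ord0 i by rewrite mxE liftK.
rewrite (@reindex_esum _ _ _ (setT `*`` (fun=> setT)) setT e); last first.
  split=> //.
    move=> [a v] [b w] _ _ E; congr pair.
      by have := congr1 (fun m : 'rV[nat]_d.+1 => m ord0 ord0) E; rewrite !e0.
    apply/rowP => i.
    by have := congr1 (fun m : 'rV[nat]_d.+1 => m ord0 (lift ord0 i)) E;
      rewrite !eS.
  move=> v _; exists (v ord0 ord0, \row_i v ord0 (lift ord0 i)) => //.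
  by apply/rowP => i; case: (unliftP ord0 i) => [j|] ->; rewrite ?e0 ?eS ?mxE.
under eq_esum => z _.
  rewrite big_ord_recl e0; under eq_bigr do rewrite eS; over.
rewrite -(@esum_esum _ _ _ setT (fun=> setT) (fun a (v : 'rV[nat]_d) =>
    mu ord0 [set a] * \prod_(i < d) mu (lift ord0 i) [set v ord0 i])%E);
  last by move=> a v _ _; rewrite mule_ge0// prode_ge0.
under eq_esum => a _.
  rewrite -[mu ord0 [set a]]fineK ?fin_num_measure// esumZl ?fine_ge0//;
    last by move=> v; exact: prode_ge0.
  rewrite (IH (fun i => mu (lift ord0 i))) mule1 fineK ?fin_num_measure//.
  over.
rewrite -nneseries_esumT// -(@probability_setT _ _ _ (mu ord0)).
rewrite (_ : [set: nat] = \bigcup_n [set n]); last first.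
  by apply/seteqP; split => // n _; exists n.
rewrite measure_bigcup//; last by move=> i j _ _ [x [/= -> ->]].
by apply: eq_eseriesl => n; rewrite in_setT.
Qed.

HB.instance Definition _ (R : realType) d (mu : 'I_d -> probability nat R) :=
  Measure_isProbability.Build _ _ _ (product_law mu) (esum_rV_prod1 mu).

(* The second argument of [poisson_prob] is not used. For a negative parameter
   [poisson_prob] is the Dirac mass at 0, as for the parameter 0. *)
Definition Po (R : realType) (d : nat) (mu : 'rV[R]_d) :
    probability 'rV[nat]_d R :=
  product_law (fun i => poisson_prob (mu ord0 i) 0%N : probability nat R).

Definition Be (R : realType) (d : nat) (p : 'rV[R]_d)
    (A : set 'rV[nat]_d) : \bar R :=
  (\sum_(i < d) (p ord0 i)%:E * \d_(delta_mx ord0 i : 'rV[nat]_d) A +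
   (1 - \sum_(i < d) p ord0 i)%R%:E * \d_(0%R : 'rV[nat]_d) A)%E.

Definition rV_natr (R : realType) (d : nat) (k : 'rV[nat]_d) : 'rV[R]_d :=
  map_mx (fun n => n%:R) k.

Definition cvg_in_distribution d0 (T : measurableType d0) (R : realType)
    (P : probability T R) (d : nat) (X : nat -> {RV P >-> 'rV[nat]_d})
    (mu : probability 'rV[nat]_d R) : Prop :=
  forall f : 'rV[R]_d -> R, continuous f ->
    (exists M, forall x, `|f x| <= M) ->
    ('E_P[fun w => f (rV_natr R (X n w))] @[n --> \oo] -->
     \int[mu]_k (f (rV_natr R k))%:E)%E.

(* The value is an extended real so that an infinite derivative is +oo; the limit
   of a divergent real-valued quotient would be an arbitrary real. *)
Definition left_partial (R : realType) (d : nat) (l : 'I_d)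
    (f : 'rV[R]_d -> R) (x : 'rV[R]_d) : \bar R :=
  lim ((h^-1 * (f (x + h *: delta_mx ord0 l) - f x))%:E @[h --> 0^'-]).

(* d^2 f / dx_j dx_l; [fine] loses nothing where df / dx_l is finite. *)
Definition left_partial2 (R : realType) (d : nat) (j l : 'I_d)
    (f : 'rV[R]_d -> R) (x : 'rV[R]_d) : \bar R :=
  left_partial j (fun y => fine (left_partial l f y)) x.

Section gwi.
Context d0 (T : measurableType d0) (R : realType) (P : probability T R).
Variable d : nat.
Implicit Types (xi : nat -> nat -> 'I_d -> {RV P >-> 'rV[nat]_d})
  (eps X : nat -> {RV P >-> 'rV[nat]_d}).

(* [inl (n, j, i)] indexes xi_{n,j,i} and [inr n] indexes eps_n. *)
Definition gwi_family xi eps (s : (nat * nat * 'I_d) + nat) :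
    {RV P >-> 'rV[nat]_d} :=
  match s with
  | inl (n, j, i) => xi n j i
  | inr n => eps n
  end.

Definition gwi_index : set ((nat * nat * 'I_d) + nat) :=
  [set s | match s with
           | inl (n, j, _) => (0 < n)%N && (0 < j)%N
           | inr n => (0 < n)%N
           end].

(* Generations n and offspring labels j start at 1: xi and eps at index 0 are
   irrelevant. *)
Record is_gwi xi eps X : Prop := IsGwi {
  gwi_indep : mutually_independent gwi_index (gwi_family xi eps) ;
  gwi_ident : forall n j i A, (0 < n)%N -> (0 < j)%N ->
    distribution P (xi n j i) A = distribution P (xi n 1%N i) A ;
  gwi_offspring_fin : forall n i l, (0 < n)%N ->
    ('E_P[fun w => (xi n 1%N i w ord0 l)%:R] < +oo)%E ;
  gwi_immigration_fin : forall n l, (0 < n)%N ->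
    ('E_P[fun w => (eps n w ord0 l)%:R] < +oo)%E ;
  gwi_init : forall w, X 0%N w = 0 ;
  gwi_step : forall n w, (0 < n)%N ->
    X n w = \sum_(i < d) \sum_(1 <= j < (X n.-1 w ord0 i).+1) xi n j i w
            + eps n w
}.

Definition offspring_mean xi (n : nat) : 'M[R]_d :=
  \matrix_(i, l) fine 'E_P[fun w => (xi n 1%N i w ord0 l)%:R].

Definition immigration_mean eps (n : nat) : 'rV[R]_d :=
  \row_l fine 'E_P[fun w => (eps n w ord0 l)%:R].

Definition offspring_pgf xi (n : nat) (i : 'I_d) (x : 'rV[R]_d) : R :=
  fine 'E_P[fun w => \prod_(l < d) x ord0 l ^+ xi n 1%N i w ord0 l].

Definition m2 xi (n : nat) : \bar R :=
  \big[maxe/-oo%E]_(i < d) \big[maxe/-oo%E]_(j < d) \big[maxe/-oo%E]_(l < d)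
    left_partial2 j l (offspring_pgf xi n i) (const_mx 1).

End gwi.

(* B_{[j,n]} = B_{j+1} ... B_n; the empty product is the identity. *)
Definition mxprod (R : realType) (d : nat) (B : nat -> 'M[R]_d)
    (j n : nat) : 'M[R]_d :=
  \prod_(j.+1 <= k < n.+1) B k.

(* Main.v *)
Require Import Defs.
From mathcomp Require Import all_boot all_order all_algebra finmap.
From mathcomp Require Import all_classical all_reals all_analysis measurable_realfun.
From mathcomp Require Import ring lra.
Set Implicit Arguments.
Unset Strict Implicit.
Unset Printing Implicit Defensive.
Import Order.TTheory GRing.Theory Num.Theory.
Import numFieldNormedType.Exports.
Local Open Scope classical_set_scope.
Local Open Scope ring_scope.

(** Write [u = 1 - x] for [x] in the unit cube. The generating function of [X n] at
    [x] is the product over [j <= n] of [1 - m_j u_(j,n)], where [1 - u_(j,n)] is the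
    image of [x] under the composition of the offspring generating functions of the
    generations [j + 1, ..., n] ([gwi_pgf_prod]). A generating function with finite
    means satisfies [1 - G_j (1 - v) = B_j v - r], where [0 <= r] and [r] is at most a
    constant times [m2(j) |v|^2] ([pgf_remainder_ge0], [pgf_remainder_le]).

    If all remainders were zero, [u_(j,n)] would be [B_[j,n] u], and the sum of the
    intensities [m_j u_(j,n)] would be [V_n u], where [V_n] is the mean of [X n].
    Because [m_j] is close to [lambda (I - B_j)], and the matrices
    [(I - B_j) B_[j,n] = B_[j,n] - B_[j-1,n]] telescope and have bounded norm sums,
    [V_n] tends to [lambda] ([mean_gwi_cvg]). The remainders change the sum of the
    intensities by the sum of the [V_(j-1) r_(j,n)] ([sum_mean_telescope]). As
    [B_[j,n] = (I - B_j)^-1 ((I - B_j) B_[j,n])], the hypothesis on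
    [m2(j) |(I - B_j)^-1|] makes this sum vanish ([remainder_sum_cvg0]). The single
    intensities being uniformly small, the product tends to [exp (- lambda u)]
    ([prod_pgf_cvg]), which is the generating function of [Po lambda] ([pgf_Po]). All
    these limits are instances of one Toeplitz lemma ([toeplitz_null]).

    Three facts of probability theory connect this computation with the process. The
    recursion for the generating functions needs the independence of a generation
    from all later vectors ([gwi_factorizes]); it is proved along with the recursion,
    by conditioning on the countably many values of a generation. The quantity
    [m2(n)] is defined by left derivatives, which are identified with factorial
    moments by monotone convergence ([left_partial2_pgf]). Finally, convergence of
    generating functions on the unit cube implies convergence in distribution
    ([cvg_in_distribution_pgf]). *)

(** * Sums and products of triangular arrays *)

Section real_sequences.
Variable R : realType.

Lemma le_expRN (a : R) : 0 <= a -> `|1 - a - expR (- a)| <= a ^+ 2.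
Proof.
move=> a0; have h1 := expR_ge1Dx (- a).
(* exp (-a) <= 1 / (1 + a) <= 1 - a + a^2. *)
have h2 : expR (- a) <= (1 + a)^-1.
  by rewrite expRN lef_pV2 ?posrE ?expR_gt0 ?expR_ge1Dx// ltr_pwDl.
have h3 : (1 + a)^-1 <= 1 - a + a ^+ 2.
  rewrite -[leLHS]mul1r ler_pdivrMr ?ltr_pwDl//.
  have : 0 <= a ^+ 3 by rewrite exprn_ge0.
  by nra.
by rewrite ler_norml; apply/andP; split; lra.
Qed.

(** Replacing the factors one at a time costs at most the distance of the
    replaced factors, because all the other factors are bounded by 1. *)
Lemma dist_prod_le (I : Type) (s : seq I) (Q : pred I) (a b : I -> R) :
  (forall i, Q i -> `|a i| <= 1) -> (forall i, Q i -> `|b i| <= 1) ->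
  `|\prod_(i <- s | Q i) a i - \prod_(i <- s | Q i) b i|
    <= \sum_(i <- s | Q i) `|a i - b i|.
Proof.
move=> ha hb; elim: s => [|i s IH]; first by rewrite !big_nil subrr normr0.
rewrite !big_cons; case: ifP => // Qi.
set A := \prod_(_ <- _ | _) a _; set B := \prod_(_ <- _ | _) b _.
have hB : `|B| <= 1 by rewrite /B normr_prod prodr_ile1// => j Qj; rewrite normr_ge0 hb.
rewrite (_ : a i * A - b i * B = a i * (A - B) + (a i - b i) * B); last by ring.
apply: le_trans (ler_normD _ _) _; rewrite !normrM addrC lerD//.
  by rewrite ler_piMr.
by apply: le_trans IH; rewrite ler_piMl// ha.
Qed.

(** The Toeplitz argument behind every limit below: the rows of [w] have bounded
    sums, so the terms with [j] large contribute at most [C] times a small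
    [delta j], while the finitely many remaining columns vanish one by one. The
    domination by [w] is only asked from [n0] on, where the hypotheses on the
    branching mechanism are effective. *)
Lemma toeplitz_null (a w : nat -> nat -> R) (delta : nat -> R) (C : R) (n0 : nat) :
  (forall j n, 0 <= a j n) ->
  (forall j n, (0 < j <= n)%N -> 0 <= w j n) ->
  (forall j, (0 < j)%N -> a j n @[n --> \oo] --> 0) ->
  (forall j n, (n0 <= j)%N -> (0 < j <= n)%N -> a j n <= delta j * w j n) ->
  (forall n, \sum_(1 <= j < n.+1) w j n <= C) ->
  delta @ \oo --> 0 ->
  \sum_(1 <= j < n.+1) a j n @[n --> \oo] --> 0.
Proof.
move=> a0 w0 acvg aw wC delta0; apply/cvgr0Pnorm_le => e e0.
(* Beyond K the domination yields a sum of at most c * C <= e / 2. *)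
pose c := e / 2 / (`|C| + 1).
have C1 : 0 < `|C| + 1 by rewrite ltr_wpDl.
have c0 : 0 < c by rewrite !divr_gt0.
have [J _ hJ] := (@cvgr0Pnorm_le _ _ _ _ _ _).1 delta0 _ c0.
pose K := (maxn n0 J).+1.
have head0 : \sum_(1 <= j < K) a j n @[n --> \oo] --> 0.
  rewrite [X in _ --> X](_ : 0 = \sum_(1 <= j < K) (0 : R)); last by rewrite big1.
  rewrite [X in _ --> X]big_seq; under eq_fun do rewrite big_seq.
  apply: cvg_big; first exact: add_continuous.
  by move=> j; rewrite mem_index_iota => /andP[j1 _]; exact: acvg.
have e20 : 0 < e / 2 by rewrite divr_gt0.
near=> n.
have Kn : (K <= n)%N by near: n; exact: nbhs_infty_ge.
have hn : `|\sum_(1 <= j < K) a j n| <= e / 2.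
  by near: n; exact: (@cvgr0Pnorm_le _ _ _ _ _ _).1 head0 _ e20.
rewrite (@big_cat_nat _ _ _ K)//=; last exact: leqW.
rewrite (splitr e) (le_trans (ler_normD _ _))// lerD//.
rewrite ger0_norm; last exact: sumr_ge0.
apply: (@le_trans _ _ (\sum_(K <= j < n.+1) c * w j n)).
  rewrite big_nat_cond [leRHS]big_nat_cond; apply: ler_sum => j.
  rewrite andbT => /andP[Kj jn].
  have jJ : (J <= j)%N by rewrite (leq_trans _ Kj)// leqW// leq_maxr.
  have jn0 : (n0 <= j)%N by rewrite (leq_trans _ Kj)// leqW// leq_maxl.
  have j1 : (0 < j <= n)%N by rewrite (leq_trans _ Kj).
  rewrite (le_trans (aw _ _ jn0 j1))// ler_wpM2r ?w0//.
  by rewrite (le_trans (ler_norm _))// hJ.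
rewrite -mulr_sumr; apply: (@le_trans _ _ (c * (`|C| + 1))); last first.
  by rewrite /c divfK// gt_eqF.
rewrite ler_pM2l//.
apply: (@le_trans _ _ (\sum_(1 <= j < n.+1) w j n)); last first.
  by rewrite (le_trans (wC n))// (le_trans (ler_norm _))// lerDl.
rewrite [leRHS](@big_cat_nat _ _ _ K)//=; last exact: leqW.
rewrite lerDr big_nat_cond; apply: sumr_ge0 => j.
rewrite andbT => /andP[j1 jK]; rewrite w0// j1/=.
by rewrite -ltnS (leq_trans jK)// ltnW.
Unshelve. all: by end_near. Qed.

(** The error in replacing [1 - a] by [exp (- a)] is at most [a ^ 2], and these
    errors add up since all factors lie between 0 and 1. *)
Lemma cvg_prod_expR (a : nat -> nat -> R) (l : R) :
  (forall j n, (0 < j <= n)%N -> 0 <= a j n <= 1) ->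
  \sum_(1 <= j < n.+1) a j n @[n --> \oo] --> l ->
  \sum_(1 <= j < n.+1) (a j n) ^+ 2 @[n --> \oo] --> 0 ->
  \prod_(1 <= j < n.+1) (1 - a j n) @[n --> \oo] --> expR (- l).
Proof.
move=> a01 al a20.
have expl : \prod_(1 <= j < n.+1) expR (- a j n) @[n --> \oo] --> expR (- l).
  under eq_fun do rewrite -expR_sum sumrN.
  by apply: continuous_cvg; [exact: continuous_expR|exact: cvgN].
rewrite -[expR _]add0r.
have E n : \prod_(1 <= j < n.+1) (1 - a j n) =
    (\prod_(1 <= j < n.+1) (1 - a j n) - \prod_(1 <= j < n.+1) expR (- a j n)) +
    \prod_(1 <= j < n.+1) expR (- a j n) by rewrite subrK.
under eq_fun do rewrite E.
apply: cvgD expl; apply/norm_cvg0P; apply: squeeze_cvgr (@cvg_cst _ 0 _ _ _) a20.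
apply: nearW => n; rewrite normr_ge0/=.
rewrite big_nat_cond [X in _ - X]big_nat_cond [leRHS]big_nat_cond.
apply: le_trans (dist_prod_le _ _ _) _; last 1 first.
- by apply: ler_sum => j; rewrite andbT ltnS => /a01/andP[? _]; exact: le_expRN.
- by move=> j; rewrite andbT ltnS => /a01/andP[? ?]; rewrite ger0_norm; lra.
- move=> j; rewrite andbT ltnS => /a01/andP[? ?].
  by rewrite ger0_norm ?expR_ge0// -expR0 ler_expR oppr_le0.
Qed.

End real_sequences.

(** * Matrix norms *)

Section matrix_norm.
Variable R : realType.

Lemma ler_mx_entry m n (A : 'M[R]_(m, n)) i j : `|A i j| <= `|A|.
Proof.
by rewrite [leRHS]/Num.norm/= mx_normrE; apply/bigmax_geP; right => /=; exists (i, j).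
Qed.

Lemma mx_norm_le m n (A : 'M[R]_(m, n)) c : 0 <= c ->
  (forall i j, `|A i j| <= c) -> `|A| <= c.
Proof.
by move=> c0 Ac; rewrite [leLHS]/Num.norm/= mx_normrE; apply/bigmax_leP; split.
Qed.

Lemma ler_norm_mulmx m n p (A : 'M[R]_(m, n)) (B : 'M[R]_(n, p)) :
  `|A *m B| <= n%:R * `|A| * `|B|.
Proof.
apply: mx_norm_le => [|i k]; first by rewrite !mulr_ge0.
rewrite mxE (le_trans (ler_norm_sum _ _ _))//.
apply: (@le_trans _ _ (\sum_(j < n) `|A| * `|B|)).
  by apply: ler_sum => j _; rewrite normrM ler_pM// ler_mx_entry.
by rewrite sumr_const card_ord -mulrA mulr_natl.
Qed.

Lemma cvg_mx m n (A : nat -> 'M[R]_(m, n)) (L : 'M[R]_(m, n)) :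
  (forall i j, A k i j @[k --> \oo] --> L i j) -> A @ \oo --> L.
Proof.
move=> h; apply/cvgrPdist_le => e e0.
have : \forall k \near \oo, forall ij, `|L ij.1 ij.2 - A k ij.1 ij.2| <= e.
  by apply: filter_forall => -[i j]; exact: (@cvgrPdist_le _ _ _ _ _ _ _).1 (h i j) _ e0.
apply: filterS => k hk; apply: mx_norm_le => [|i j]; first exact: ltW.
by rewrite !mxE; exact: (hk (i, j)).
Qed.

Lemma cvg_mx_entry m n (A : nat -> 'M[R]_(m, n)) (L : 'M[R]_(m, n)) i j :
  A @ \oo --> L -> A k i j @[k --> \oo] --> L i j.
Proof.
move=> /cvgrPdist_le h; apply/cvgrPdist_le => e /h; apply: filterS => k.
by apply: le_trans; have := ler_mx_entry (L - A k) i j; rewrite !mxE.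
Qed.

Lemma cvg_mulmx m n p (A : nat -> 'M[R]_(m, n)) (B : nat -> 'M[R]_(n, p))
    (LA : 'M[R]_(m, n)) (LB : 'M[R]_(n, p)) :
  A @ \oo --> LA -> B @ \oo --> LB -> A k *m B k @[k --> \oo] --> LA *m LB.
Proof.
move=> hA hB; apply: cvg_mx => i j; rewrite mxE.
under eq_fun do rewrite mxE.
apply: cvg_big => [|l _]; first exact: add_continuous.
by apply: cvgM; exact: cvg_mx_entry.
Qed.

End matrix_norm.

Section norms.
Variables (R : realType) (d : nat) (N : 'rV[R]_d -> R).
Hypothesis hN : is_norm N.

Lemma is_norm0 : N 0 = 0.
Proof. by case: hN => _ NZ _; rewrite -(scale0r 0) NZ normr0 mul0r. Qed.

Lemma is_norm_ge0 x : 0 <= N x.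
Proof.
case: hN => ND NZ _; have := ND x (-1 *: x).
by rewrite NZ normrN1 mul1r scaleN1r subrr is_norm0 -mulr2n pmulrn_lge0.
Qed.

Lemma is_norm_sum (I : Type) (s : seq I) (F : I -> 'rV[R]_d) :
  N (\sum_(i <- s) F i) <= \sum_(i <- s) N (F i).
Proof.
case: hN => ND _ _; elim: s => [|i s IH]; first by rewrite !big_nil is_norm0.
by rewrite !big_cons (le_trans (ND _ _))// lerD2l.
Qed.

Lemma is_norm_le : exists2 M, 0 <= M & forall x, N x <= M * `|x|.
Proof.
exists (\sum_(i < d) N (delta_mx 0 i)); first by rewrite sumr_ge0// => i _; exact: is_norm_ge0.
move=> x; rewrite {1}(row_sum_delta x) (le_trans (is_norm_sum _ _))//.
rewrite mulr_suml; apply: ler_sum => i _; case: hN => _ NZ _.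
by rewrite NZ mulrC ler_wpM2l ?is_norm_ge0// ler_mx_entry.
Qed.

Lemma is_norm_continuous : continuous N.
Proof.
case: is_norm_le => M M0 NM; case: hN => ND NZ _.
have M1 : 0 < M + 1 by rewrite ltr_wpDl.
have NB y z : N y - N z <= M * `|y - z|.
  by rewrite lerBlDr (le_trans _ (lerD (NM _) (lexx _)))// -{1}(subrK z y).
have H (x : 'rV[R]_d) (e : R) : 0 < e -> \forall y \near nbhs x, `|N x - N y| <= e.
  move=> e0; apply/(@nbhs_normP _ 'rV[R]_d x); exists (e / (M + 1)); first by rewrite /= divr_gt0.
  move=> y /= /ltW hy.
  have {}hy : M * `|x - y| <= e.
    rewrite (le_trans (ler_wpM2l M0 hy))// mulrA ler_pdivrMr//.
    by rewrite mulrC ler_pM2l// lerDl.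
  rewrite ler_norml lerNl opprB (le_trans (NB _ _))//=; last by rewrite distrC.
  by rewrite (le_trans (NB _ _)).
by move=> x; apply/(@cvgrPdist_le _ _ _ (nbhs (x : 'rV[R]_d))) => e; exact: H.
Qed.

Hypothesis d0 : (0 < d)%N.

(** The norm [N] attains a positive minimum on the compact unit sphere of the
    maximum norm. *)
Lemma is_norm_ge : exists2 c, 0 < c & forall x, `|x| <= c * N x.
Proof.
pose S : set 'rV[R]_d := [set x | `|x| = 1].
have cS : compact S.
  apply: bounded_closed_compact.
    by exists 1; split => // M M1 x /= ->; exact: ltW.
  have -> : S = (fun x : 'rV[R]_d => `|x|) @^-1` [set 1] by [].
  apply: closed_comp; last exact: closed_eq.
  by move=> x _; exact: norm_continuous.
pose e := delta_mx 0 (Ordinal d0) : 'rV[R]_d.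
have e0 : `|e| != 0.
  rewrite normr_eq0; apply/eqP => /matrixP/(_ 0 (Ordinal d0))/eqP.
  by rewrite !mxE !eqxx/= oner_eq0.
have S0 : S !=set0.
  by exists (`|e|^-1 *: e); rewrite /S/= normrZ normfV normr_id mulVf.
have [c cS' hc] := EVT_min_rV S0 cS (continuous_subspaceT is_norm_continuous).
have c1 : `|c| = 1 by rewrite inE in cS'.
have Nc : 0 < N c.
  rewrite lt_neqAle is_norm_ge0 andbT eq_sym; apply/eqP.
  case: hN => _ _ /[apply] c0; move: c1; rewrite c0 normr0 => /eqP.
  by rewrite eq_sym oner_eq0.
exists (N c)^-1; first by rewrite invr_gt0.
move=> x; have [->|x0] := eqVneq x 0; first by rewrite normr0 is_norm0 mulr0.
have nx : 0 < `|x| by rewrite normr_gt0.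
have : N c <= N (`|x|^-1 *: x).
  by apply: hc; rewrite inE /S/= normrZ normfV normr_id mulVf// gt_eqF.
case: hN => _ NZ _; rewrite NZ normfV normr_id mulrC ler_pdivlMr// mulrC => h.
by rewrite mulrC ler_pdivlMr.
Qed.

(** Finiteness of the supremum requires both halves of the equivalence of norms. *)
Lemma opnorm_has_sup (A : 'M[R]_d) : has_sup [set N (x *m A) | x in [set x | N x <= 1]].
Proof.
split; first by exists (N (0 *m A)); exists 0 => //=; rewrite is_norm0 ler01.
case: is_norm_le => M M0 NM; case: is_norm_ge => c c0 hc.
exists (M * (d%:R * c * `|A|)) => _ [x /= x1 <-].
rewrite (le_trans (NM _))// ler_wpM2l// (le_trans (ler_norm_mulmx _ _))//.
rewrite ler_wpM2r// ler_wpM2l// (le_trans (hc _))//.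
by rewrite ler_piMr// ltW.
Qed.

Lemma le_opnorm (A : 'M[R]_d) x : N (x *m A) <= opnorm N A * N x.
Proof.
have [->|x0] := eqVneq x 0; first by rewrite mul0mx is_norm0 mulr0.
have Nx : 0 < N x.
  rewrite lt_neqAle is_norm_ge0 andbT eq_sym; apply/eqP.
  by case: hN => _ _ /[apply] h; rewrite h eqxx in x0.
case: hN => _ NZ _.
rewrite -ler_pdivrMr// (_ : _ / _ = N (((N x)^-1 *: x) *m A)); last first.
  by rewrite -scalemxAl NZ mulrC ger0_norm// invr_ge0 ltW.
apply: ub_le_sup; first by case: (opnorm_has_sup A).
exists ((N x)^-1 *: x) => //=.
by rewrite NZ ger0_norm ?invr_ge0 ?(ltW Nx)// mulVf// gt_eqF.
Qed.

Lemma opnorm_ge0 (A : 'M[R]_d) : 0 <= opnorm N A.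
Proof.
apply: ub_le_sup; first by case: (opnorm_has_sup A).
by exists 0; rewrite /= ?mul0mx is_norm0.
Qed.

(** The bridge between operator norms and entries: row [i] of [A] is the image of
    the [i]-th basis vector, whose norm is bounded, and the two norms are
    equivalent. Taking [K] to be the operator norm of [A] shows that whatever is
    small for [opnorm N] has small entries. *)
Lemma mx_norm_le_lipschitz : exists2 c, 0 <= c & forall (A : 'M[R]_d) K,
  (forall x, N (x *m A) <= K * N x) -> `|A| <= c * K.
Proof.
case: is_norm_le => M M0 NM; case: is_norm_ge => c c0 hc.
exists (c * M); first by rewrite mulr_ge0// ltW.
move=> A K hK.
have K0 : 0 <= K.
  pose e := delta_mx 0 (Ordinal d0) : 'rV[R]_d.
  have e0 : 0 < N e.
    rewrite lt_neqAle is_norm_ge0 andbT eq_sym; apply/eqP.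
    case: hN => _ _ /[apply] /matrixP/(_ 0 (Ordinal d0))/eqP.
    by rewrite !mxE !eqxx/= oner_eq0.
  by rewrite -(pmulr_lge0 _ e0) (le_trans _ (hK e))// is_norm_ge0.
apply: mx_norm_le => [|i j]; first by rewrite !mulr_ge0// ltW.
have -> : A i j = row i A 0 j by rewrite mxE.
rewrite rowE.
rewrite (le_trans (ler_mx_entry _ _ _))// (le_trans (hc _))// -!mulrA.
rewrite ler_wpM2l ?(ltW c0)// (le_trans (hK _))// mulrC ler_wpM2r//.
rewrite (le_trans (NM _))// ler_piMr//; apply: mx_norm_le => // k l.
by rewrite mxE; case: (_ && _); rewrite ?normr1 ?normr0.
Qed.

End norms.

(** * Products of the mean matrices and the Poisson limit *)

Section mean_matrices.
Variables (R : realType) (d : nat) (B : nat -> 'M[R]_d).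

Lemma mxprodnn n : mxprod B n n = 1%:M.
Proof. by rewrite /mxprod big_geq// -idmxE. Qed.

Lemma mxprodSr j n : (j <= n)%N -> mxprod B j n.+1 = mxprod B j n *m B n.+1.
Proof. by move=> jn; rewrite /mxprod big_nat_recr. Qed.

Lemma mxprodSl j n : (j < n)%N -> mxprod B j n = B j.+1 *m mxprod B j.+1 n.
Proof. by move=> jn; rewrite /mxprod big_ltn. Qed.

(** Each factor is a contraction for [N], hence so are the products. *)
Lemma mxprod_bounded (N : 'rV[R]_d -> R) (n0 : nat) : is_norm N -> (0 < d)%N ->
  (forall n, (n0 <= n)%N -> opnorm N (B n) <= 1) ->
  exists2 K, 0 <= K & forall j n, (n0 <= j)%N -> (j <= n)%N -> `|mxprod B j n| <= K.
Proof.
move=> hN d0 B1; have [c c0 hc] := mx_norm_le_lipschitz hN d0.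
exists c => // j n n0j jn; rewrite -[c]mulr1; apply: hc => x; rewrite mul1r.
elim: n jn => [|n IH]; first by rewrite leqn0 => /eqP ->; rewrite mxprodnn mulmx1.
rewrite leq_eqVlt => /predU1P[->|]; first by rewrite mxprodnn mulmx1.
rewrite ltnS => jn; rewrite mxprodSr// mulmxA.
rewrite (le_trans (le_opnorm hN d0 _ _))// (le_trans _ (IH jn))//.
rewrite ler_piMl ?is_norm_ge0// B1// (leq_trans n0j)// ltnW//.
Qed.

End mean_matrices.

Section vanishing_branching.
Variables (R : realType) (d : nat).
Variables (B : nat -> 'M[R]_d) (m : nat -> 'rV[R]_d) (lambda : 'rV[R]_d).
Variables (n0 : nat) (K C : R).
Hypothesis B_cvg1 : B @ \oo --> (1%:M : 'M[R]_d).
Hypothesis mxprod_le : forall j n, (n0 <= j)%N -> (j <= n)%N -> `|mxprod B j n| <= K.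
Hypothesis B_unit : forall n, (n0 <= n)%N -> 1%:M - B n \in unitmx.
Hypothesis mxprod_cvg0 : forall j, mxprod B j n @[n --> \oo] --> (0 : 'M[R]_d).
Hypothesis sum_le : forall n,
  \sum_(1 <= j < n.+1) `|(1%:M - B j) *m mxprod B j n| <= C.
Hypothesis m_cvg : m n *m invmx (1%:M - B n) @[n --> \oo] --> lambda.

Let mE j : (n0 <= j)%N -> m j = m j *m invmx (1%:M - B j) *m (1%:M - B j).
Proof. by move=> /B_unit ju; rewrite mulmxKV. Qed.

Let IB_cvg0 : 1%:M - B n @[n --> \oo] --> (0 : 'M[R]_d).
Proof. by rewrite -[X in _ --> X](subrr (1%:M : 'M[R]_d)); apply: cvgB => //; exact: cvg_cst. Qed.

Lemma immigration_cvg0 : m @ \oo --> (0 : 'rV[R]_d).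
Proof.
have := cvg_mulmx m_cvg IB_cvg0; rewrite mulmx0; apply: cvg_trans.
apply: near_eq_cvg; near=> n; rewrite -mE//; near: n; exact: nbhs_infty_ge.
Unshelve. all: by end_near. Qed.

(** The mean vector of the n-th generation. Its limit governs everything: it
    carries the main term of the sum of the immigration intensities, and it
    weighs the errors made in each generation. *)
Definition mean_gwi (n : nat) : 'rV[R]_d :=
  iteri n (fun k v => v *m B k.+1 + m k.+1) 0.

Lemma mean_gwiS n : mean_gwi n.+1 = mean_gwi n *m B n.+1 + m n.+1.
Proof. by []. Qed.

(* The part of the immigration mean that keeps the process off the equilibrium
   mean lambda. *)
Let e j := m j - lambda *m (1%:M - B j).

(** Since [lambda] is a fixed point of [v |-> v B_n + lambda (I - B_n)], the
    deviation from [lambda] is transported by the products of the mean matrices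
    and fed by the terms [e j]. *)
Lemma mean_gwiE n : mean_gwi n - lambda =
  \sum_(1 <= j < n.+1) e j *m mxprod B j n - lambda *m mxprod B 0 n.
Proof.
elim: n => [|n IH]; first by rewrite big_geq// mxprodnn mulmx1 !sub0r.
rewrite big_nat_recr//= mxprodnn mulmx1 (mxprodSr _ (leq0n n)) mulmxA.
rewrite big_nat_cond; under eq_bigr => j.
  rewrite andbT ltnS => /andP[_ jn]; rewrite (mxprodSr _ jn) mulmxA; over.
rewrite -big_nat_cond -mulmx_suml.
have -> : \sum_(1 <= j < n.+1) e j *m mxprod B j n =
    mean_gwi n - lambda + lambda *m mxprod B 0 n by rewrite IH subrK.
rewrite mulmxDl mulmxBl [RHS]addrAC addrK /e mulmxBr mulmx1 opprB.
by rewrite addrACA addKr.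
Qed.

(** From [n0] on, [e j = (m_j (I - B_j)^-1 - lambda) (I - B_j)], so that
    [e j B_[j,n]] is a null sequence times a matrix [(I - B_j) B_[j,n]], and these
    have bounded sums. *)
Lemma mean_gwi_cvg : mean_gwi @ \oo --> lambda.
Proof.
suff h : mean_gwi n - lambda @[n --> \oo] --> (0 : 'rV[R]_d) by apply/subr_cvg0.
rewrite (funext mean_gwiE) -[X in _ --> X](subr0 (0 : 'rV[R]_d)); apply: cvgB; last first.
  rewrite -(mulmx0 _ lambda); apply: cvg_mulmx; last exact: mxprod_cvg0.
  exact: cvg_cst.
apply/norm_cvg0P.
apply: (@squeeze_cvgr _ _ _ _ (fun=> 0)
  (fun n => \sum_(1 <= j < n.+1) `|e j *m mxprod B j n|)).
- by apply: nearW => n; rewrite normr_ge0/= ler_norm_sum.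
- exact: cvg_cst.
apply: (@toeplitz_null _ _ (fun j n => `|(1%:M - B j) *m mxprod B j n|)
  (fun j => d%:R * `|m j *m invmx (1%:M - B j) - lambda|) C n0) => //.
- move=> j _; apply/norm_cvg0P; rewrite -(mulmx0 _ (e j)).
  by apply: cvg_mulmx; [exact: cvg_cst|exact: mxprod_cvg0].
- move=> j n jn0 _; rewrite /e {1}mE// -mulmxBl -mulmxA; exact: ler_norm_mulmx.
- rewrite -(mulr0 d%:R); apply: cvgM; first exact: cvg_cst.
  by apply/norm_cvg0P; apply/subr_cvg0.
Qed.

Hypothesis m_ge0 : forall n i, (0 < n)%N -> 0 <= m n 0 i.
Hypothesis B_ge0 : forall n i l, (0 < n)%N -> 0 <= B n i l.

Lemma mean_gwi_ge0 n i : 0 <= mean_gwi n 0 i.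
Proof.
elim: n i => [|n IH] i; first by rewrite mxE.
rewrite mean_gwiS !mxE addr_ge0 ?m_ge0// sumr_ge0// => k _.
by rewrite mulr_ge0 ?B_ge0.
Qed.

(** The vectors [m_n (I - B_n)^-1] may have negative entries, but their limit is
    also the limit of the mean vectors. *)
Lemma limit_mean_ge0 i : 0 <= lambda 0 i.
Proof.
have h := @cvg_mx_entry _ _ _ _ _ 0 i mean_gwi_cvg.
rewrite -(cvg_lim _ h)//; apply: limr_ge; first by apply/cvg_ex; exists (lambda 0 i).
by apply: nearW => n; exact: mean_gwi_ge0.
Qed.

(* In the application, 1 - (u j n)^T is the image of a point of the unit cube
   under the composition of the offspring generating functions of the generations
   j + 1, ..., n, and r j n is the nonlinear part of the one of generation j. *)
Variables (u0 : 'cV[R]_d) (u r : nat -> nat -> 'cV[R]_d) (c : nat -> R).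
Hypothesis u_end : forall n, u n n = u0.
Hypothesis u_step : forall j n, (j < n)%N -> u j n = B j.+1 *m u j.+1 n - r j.+1 n.
Hypothesis u_ge0 : forall j n i, (j <= n)%N -> 0 <= u j n i 0.
Hypothesis r_ge0 : forall j n i, (0 < j <= n)%N -> 0 <= r j n i 0.
Hypothesis mu_le1 : forall j n, (0 < j <= n)%N -> (m j *m u j n) 0 0 <= 1.
Hypothesis c_ge0 : forall j, 0 <= c j.
Hypothesis r_le : forall j n, (n0 <= j)%N -> (0 < j <= n)%N -> `|r j n| <= c j * `|u j n| ^+ 2.
Hypothesis c_cvg0 : c n * `|invmx (1%:M - B n)| @[n --> \oo] --> (0 : R).

(** Dropping the nonnegative remainders leaves the linear recursion. *)
Lemma iterate_le j n i : (j <= n)%N -> u j n i 0 <= (mxprod B j n *m u0) i 0.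
Proof.
move=> jn; have [k kn] : exists k, (j + k = n)%N by exists (n - j)%N; rewrite subnKC.
elim: k j i jn kn => [|k IH] j i jn kn.
  by rewrite -kn addn0 mxprodnn mul1mx u_end.
have lt : (j < n)%N by rewrite -kn addnS ltnS leq_addr.
rewrite u_step// mxprodSl//.
apply: (@le_trans _ _ ((B j.+1 *m u j.+1 n) i 0)).
  by rewrite !mxE gerBl r_ge0.
rewrite -mulmxA !mxE; apply: ler_sum => l _.
by rewrite ler_wpM2l ?B_ge0// IH// addSnnS.
Qed.

Lemma norm_iterate_le j n : (j <= n)%N -> `|u j n| <= `|mxprod B j n *m u0|.
Proof.
move=> jn; apply: mx_norm_le => // i l; rewrite (ord1 l) ger0_norm ?u_ge0//.
by rewrite (le_trans (iterate_le _ jn))// (le_trans (ler_norm _))// ler_mx_entry.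
Qed.

(** A remainder is at most [c_j |B_[j,n]|^2]; one factor is bounded, and the other
    is written as [(I - B_j)^-1 ((I - B_j) B_[j,n])], so that [c_j] meets the norm
    of the inverse while the rest has bounded sums. Each single remainder vanishes
    because it is dominated by the linear term [B_[j-1,n] u0]. *)
Lemma remainder_sum_cvg0 : \sum_(1 <= j < n.+1) `|r j n| @[n --> \oo] --> (0 : R).
Proof.
apply: (@toeplitz_null _ _ (fun j n => `|(1%:M - B j) *m mxprod B j n|)
  (fun j => c j * `|invmx (1%:M - B j)| * (d%:R ^+ 3 * K * `|u0| ^+ 2)) C n0) => //.
- move=> [//|j] _.
  apply: (@squeeze_cvgr _ _ _ _ (fun=> 0) (fun n => `|mxprod B j n *m u0|)).
  + near=> n; rewrite normr_ge0/=; have jn : (j < n)%N by near: n; exact: nbhs_infty_ge.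
    apply: mx_norm_le => // i l; rewrite (ord1 l) ger0_norm ?r_ge0//.
    have : 0 <= u j n i 0 by rewrite u_ge0// ltnW.
    rewrite u_step// !mxE subr_ge0 => /le_trans; apply.
    apply: (@le_trans _ _ ((mxprod B j n *m u0) i 0)); last first.
      by rewrite (le_trans (ler_norm _))// ler_mx_entry.
    rewrite mxprodSl// -mulmxA [leRHS]mxE; apply: ler_sum => k _.
    by rewrite ler_wpM2l ?B_ge0// iterate_le.
  + exact: cvg_cst.
  + apply/norm_cvg0P; rewrite -(mul0mx _ u0); apply: cvg_mulmx; first exact: mxprod_cvg0.
    exact: cvg_cst.
- move=> j n jn0 /[dup] jn /andP[j0 j_n]; rewrite (le_trans (r_le _ _))//.
  rewrite -!mulrA ler_wpM2l//.
  have h1 : `|u j n| <= d%:R * `|mxprod B j n| * `|u0|.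
    by rewrite (le_trans (norm_iterate_le _))// ler_norm_mulmx.
  have h2 : `|mxprod B j n| <= d%:R * `|invmx (1%:M - B j)| * `|(1%:M - B j) *m mxprod B j n|.
    by rewrite -{1}(mulKmx (B_unit jn0) (mxprod B j n)) ler_norm_mulmx.
  rewrite (@le_trans _ _ ((d%:R * `|mxprod B j n| * `|u0|) ^+ 2))//.
    by rewrite ler_pXn2r ?nnegrE// mulr_ge0// mulr_ge0.
  rewrite (_ : _ ^+ 2 = d%:R ^+ 2 * `|u0| ^+ 2 * (`|mxprod B j n| * `|mxprod B j n|)); last by ring.
  rewrite (@le_trans _ _ (d%:R ^+ 2 * `|u0| ^+ 2 *
    (K * (d%:R * `|invmx (1%:M - B j)| * `|(1%:M - B j) *m mxprod B j n|))))//.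
    rewrite ler_wpM2l ?mulr_ge0 ?exprn_ge0//; apply: ler_pM => //; exact: mxprod_le.
  by rewrite le_eqVlt; apply/predU1P; left; ring.
- rewrite -(mul0r (d%:R ^+ 3 * K * `|u0| ^+ 2)); apply: cvgM => //; exact: cvg_cst.
Unshelve. all: by end_near. Qed.

Local Notation a j n := ((m j *m u j n) 0 0).

(** The increments of [k |-> mean_gwi k u_(k,n)] are exactly
    [m_k u_(k,n) + mean_gwi (k-1) r_(k,n)]; this avoids expanding the iterates as
    double sums of remainders. *)
Lemma sum_mean_telescope n : \sum_(1 <= j < n.+1) a j n =
  (mean_gwi n *m u0) 0 0 - \sum_(1 <= j < n.+1) (mean_gwi j.-1 *m r j n) 0 0.
Proof.
pose f k := (mean_gwi k *m u k n) 0 0.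
have : f n - f 0%N = \sum_(1 <= j < n.+1) (a j n + (mean_gwi j.-1 *m r j n) 0 0).
  rewrite -telescope_sumr// big_add1/= !big_nat; apply: eq_bigr => k /andP[_ kn].
  have D (A1 A2 : 'M[R]_1) : (A1 + A2) 0 0 = A1 0 0 + A2 0 0 by rewrite mxE.
  have S (A1 A2 : 'M[R]_1) : (A1 - A2) 0 0 = A1 0 0 - A2 0 0 by rewrite !mxE.
  rewrite /f -S -D mean_gwiS (u_step kn) mulmxDl mulmxBr mulmxA opprB.
  by rewrite addrC addrA subrK addrC.
rewrite /f u_end mul0mx [X in _ - X]mxE subr0 => ->.
by rewrite big_split/= addrK.
Qed.

Lemma sum_intensity_cvg :
  \sum_(1 <= j < n.+1) a j n @[n --> \oo] --> (lambda *m u0) 0 0.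
Proof.
rewrite (funext sum_mean_telescope) -[X in _ --> X]subr0; apply: cvgB.
  by apply: cvg_mx_entry; apply: cvg_mulmx; [exact: mean_gwi_cvg|exact: cvg_cst].
have /cvg_seq_bounded[M [_ hM]] : cvgn mean_gwi.
  by apply/cvg_ex; exists lambda; exact: mean_gwi_cvg.
have {}hM n : `|mean_gwi n| <= `|M| + 1.
  by apply: hM => //; rewrite (le_lt_trans (ler_norm _))// ltrDl.
apply/norm_cvg0P.
apply: (@squeeze_cvgr _ _ _ _ (fun=> 0)
  (fun n => d%:R * (`|M| + 1) * \sum_(1 <= j < n.+1) `|r j n|)).
- apply: nearW => n; rewrite normr_ge0/= (le_trans (ler_norm_sum _ _ _))//.
  rewrite mulr_sumr; apply: ler_sum => j _.
  rewrite (le_trans (ler_mx_entry _ _ _))// (le_trans (ler_norm_mulmx _ _))//.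
  by rewrite ler_wpM2r// ler_wpM2l.
- exact: cvg_cst.
- rewrite -[X in _ --> X](mulr0 (d%:R * (`|M| + 1))); apply: cvgM; first exact: cvg_cst.
  exact: remainder_sum_cvg0.
Qed.

(** The squares of the intensities [m_j u_(j,n)] have a vanishing sum: the
    intensities themselves have bounded sums, and each is at most a constant times
    [|m_j|], which tends to 0. *)
Lemma prod_pgf_cvg :
  \prod_(1 <= j < n.+1) (1 - a j n) @[n --> \oo] --> expR (- (lambda *m u0) 0 0).
Proof.
have a0 j n : (0 < j <= n)%N -> 0 <= a j n.
  move=> /andP[j0 jn]; rewrite mxE sumr_ge0// => i _.
  by rewrite mulr_ge0 ?m_ge0// u_ge0.
apply: cvg_prod_expR.
- by move=> j n jn; rewrite a0// mu_le1.
- exact: sum_intensity_cvg.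
have /cvg_seq_bounded[M [_ hM]] : cvgn (fun n => \sum_(1 <= j < n.+1) a j n : R^o).
  by apply/cvg_ex; exists ((lambda *m u0) 0 0); exact: sum_intensity_cvg.
apply: (@toeplitz_null _ _ (fun j n => a j n)
  (fun j => d%:R * `|m j| * (d%:R * K * `|u0|)) (`|M| + 1) n0) => //.
- by move=> j n; exact: sqr_ge0.
- move=> j j0; rewrite -[X in _ --> X](mulr0 0).
  suff h : a j n @[n --> \oo] --> (0 : R).
    by rewrite (_ : (fun=> _) = (fun n => a j n * a j n))//; apply: cvgM.
  apply/norm_cvg0P.
  apply: (@squeeze_cvgr _ _ _ _ (fun=> 0)
    (fun n => d%:R * `|m j| * `|mxprod B j n *m u0|)).
  + near=> n; rewrite normr_ge0/= (le_trans (ler_mx_entry _ _ _))//.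
    rewrite (le_trans (ler_norm_mulmx _ _))// ler_wpM2l ?mulr_ge0//.
    by apply: norm_iterate_le; near: n; exact: nbhs_infty_ge.
  + exact: cvg_cst.
  + rewrite -(mulr0 (d%:R * `|m j|)); apply: cvgM; first exact: cvg_cst.
    apply/norm_cvg0P; rewrite -(mul0mx _ u0).
    by apply: cvg_mulmx; [exact: mxprod_cvg0|exact: cvg_cst].
- move=> j n jn0 /[dup] jn /andP[j0 j_n]; rewrite expr2 ler_wpM2r ?a0//.
  rewrite (le_trans (ler_norm _))// (le_trans (ler_mx_entry _ _ _))//.
  rewrite (le_trans (ler_norm_mulmx _ _))// ler_wpM2l ?mulr_ge0//.
  rewrite (le_trans (norm_iterate_le _))// (le_trans (ler_norm_mulmx _ _))//.
  by rewrite ler_wpM2r// ler_wpM2l// mxprod_le.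
- move=> n; rewrite (le_trans (ler_norm _))//; apply: hM => //.
  by rewrite (le_lt_trans (ler_norm _))// ltrDl.
- rewrite -(mul0r (d%:R * K * `|u0|)); apply: cvgM; last exact: cvg_cst.
  rewrite -(mulr0 d%:R); apply: cvgM; first exact: cvg_cst.
  by apply/norm_cvg0P; exact: immigration_cvg0.
Unshelve. all: by end_near. Qed.

End vanishing_branching.

(** * From generating functions to point masses *)

Section functionals.
Variables (R : realType) (S : Type).
Implicit Types (L : (S -> R) -> R) (g h : S -> R).

Definition bounded_real g := exists M, forall z, `|g z| <= M.

(** Linear functionals of norm at most 1 on bounded functions. Working with these
    rather than with laws lets one statement serve both for the limit theorem and,
    with constant sequences, for the fact that a generating function determines a
    law jointly with an independent weight. *)
Definition subunit_functional L :=
  (forall a g h, bounded_real g -> bounded_real h ->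
     L (fun z => a * g z + h z) = a * L g + L h) /\
  (forall g M, (forall z, `|g z| <= M) -> `|L g| <= M).

Lemma bounded_real_lin a g h : bounded_real g -> bounded_real h ->
  bounded_real (fun z => a * g z + h z).
Proof.
move=> [M hM] [M' hM']; exists (`|a| * M + M') => z.
by rewrite (le_trans (ler_normD _ _))// lerD// normrM ler_wpM2l.
Qed.

Lemma bounded_real0 : bounded_real (fun=> 0).
Proof. by exists 0 => z; rewrite normr0. Qed.

Variables (Ln : nat -> (S -> R) -> R) (L0 : (S -> R) -> R).
Hypothesis hLn : forall n, subunit_functional (Ln n).
Hypothesis hL0 : subunit_functional L0.

Definition functional_cvg g := Ln n g @[n --> \oo] --> L0 g.

Lemma functional_cvg_lin a g h : bounded_real g -> bounded_real h ->
  functional_cvg g -> functional_cvg h -> functional_cvg (fun z => a * g z + h z).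
Proof.
move=> bg bh cg ch; rewrite /functional_cvg (proj1 hL0)//.
have E n : Ln n (fun z => a * g z + h z) = a * Ln n g + Ln n h.
  exact: (proj1 (hLn n)).
rewrite (funext E); apply: cvgD => //.
by apply: cvgM => //; exact: cvg_cst.
Qed.

Lemma functional_cvg0 : functional_cvg (fun=> 0).
Proof.
have L00 L : subunit_functional L -> L (fun=> 0) = 0.
  move=> hL; apply/eqP; rewrite -normr_eq0 eq_le normr_ge0 andbT.
  by apply: (proj2 hL) => z; rewrite normr0.
by rewrite /functional_cvg L00//; under eq_fun do rewrite L00//; exact: cvg_cst.
Qed.

Lemma functional_cvg_sum (I : Type) (s : seq I) (a : I -> R) (F : I -> S -> R) h :
  (forall i, bounded_real (F i)) -> (forall i, functional_cvg (F i)) ->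
  bounded_real h -> functional_cvg h ->
  bounded_real (fun z => \sum_(i <- s) a i * F i z + h z) /\
  functional_cvg (fun z => \sum_(i <- s) a i * F i z + h z).
Proof.
move=> bF cF bh ch; elim: s => [|i s [IH1 IH2]].
  rewrite (_ : (fun=> _) = h)//; apply/funext => z; by rewrite big_nil add0r.
rewrite (_ : (fun=> _) =
    fun z => a i * F i z + (\sum_(j <- s) a j * F j z + h z)); last first.
  by apply/funext => z; rewrite big_cons addrA.
by split; [exact: bounded_real_lin|exact: functional_cvg_lin].
Qed.

(** Functionals of norm at most 1 are equicontinuous for the uniform norm. *)
Lemma functional_cvg_uniform g : bounded_real g ->
  (forall e : R, 0 < e -> exists h, [/\ bounded_real h, functional_cvg h &
     forall z, `|g z - h z| <= e]) -> functional_cvg g.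
Proof.
move=> bg H; apply/cvgrPdist_le => e e0.
have e3 : 0 < e / 3 by rewrite divr_gt0.
have [h [bh ch gh]] := H _ e3.
have D L : subunit_functional L -> `|L g - L h| <= e / 3.
  move=> hL; rewrite -[L g - L h]addrC -mulN1r -(proj1 hL)//.
  by apply: (proj2 hL) => z; rewrite mulN1r addrC.
have [k _ hk] := (@cvgrPdist_le _ _ _ _ _ _ _).1 ch _ e3.
exists k => // n /= /hk {hk} hn.
have := D _ hL0; have := D _ (hLn n).
rewrite !ler_norml in hn *; move: hn => /andP[? ?] /andP[? ?] /andP[? ?].
by apply/andP; split; lra.
Qed.

(** By induction on [K]: subtracting the levels below [K] from [g y^c] and dividing
    by [y^K] leaves the level [K] up to terms [y^(c - K)] with [c > K], which are
    uniformly at most [y]. Letting [y] tend to 0 isolates the level [K]. *)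
Lemma functional_cvg_index (g : S -> R) (c : S -> nat) :
  (forall z, `|g z| <= 1) ->
  (forall y, 0 <= y <= 1 -> functional_cvg (fun z => g z * y ^+ c z)) ->
  forall K, functional_cvg (fun z => g z * (c z == K)%:R).
Proof.
move=> g1 cg; elim/ltn_ind => K IH.
have bI i : bounded_real (fun z => g z * (c z == i)%:R).
  by exists 1 => z; case: (c z == i); rewrite ?mulr1// mulr0 normr0.
apply: functional_cvg_uniform => // e e0.
pose y := Num.min e 1.
have y0 : 0 < y by rewrite lt_min e0 ltr01.
have y1 : y <= 1 by rewrite ge_min lexx orbT.
have y01 : 0 <= y <= 1 by rewrite ltW.
have by_ : bounded_real (fun z => g z * y ^+ c z).
  exists 1 => z; rewrite normrM mulr_ile1//.
  by rewrite ger0_norm ?exprn_ge0 ?exprn_ile1 ?(ltW y0).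
pose F i := if (i < K)%N then (fun z => g z * (c z == i)%:R) else (fun=> 0).
have bF i : bounded_real (F i) by rewrite /F; case: ifP => // _; exact: bounded_real0.
have cF i : functional_cvg (F i).
  by rewrite /F; case: ifP => [/IH//|_]; exact: functional_cvg0.
have [b1 c1] := functional_cvg_sum (iota 0 K) (fun i => - y ^+ i) bF cF by_ (cg _ y01).
exists (fun z => y ^- K * (\sum_(i <- iota 0 K) - y ^+ i * F i z + g z * y ^+ c z) + 0).
split; first by apply: bounded_real_lin => //; exact: bounded_real0.
  by apply: functional_cvg_lin => //; [exact: bounded_real0|exact: functional_cvg0].
move=> z; rewrite addr0.
have -> : \sum_(i <- iota 0 K) - y ^+ i * F i z =
    if (c z < K)%N then - (g z * y ^+ c z) else 0.
  rewrite (eq_big_seq (fun i => - (g z * (y ^+ i * (c z == i)%:R)))); last first.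
    by move=> i; rewrite mem_iota/= add0n => iK; rewrite /F iK; ring.
  rewrite sumrN -mulr_sumr; case: ltnP => cK.
    rewrite (bigD1_seq (c z)) ?iota_uniq ?mem_iota//= eqxx mulr1 big1 ?addr0// => i.
    by rewrite eq_sym => /negPf ->; rewrite mulr0.
  rewrite big1_seq ?mulr0 ?oppr0// => i /andP[_]; rewrite mem_iota/= add0n => iK.
  by rewrite gtn_eqF ?mulr0// (leq_trans iK).
have [cK|cK|cK] := ltngtP (c z) K.
- by rewrite addNr !mulr0 subr0 normr0 ltW.
- rewrite mulr0 !add0r normrN mulrCA normrM (le_trans (ler_piMl _ (g1 z)))//.
  rewrite -(subnK (ltnW cK)) exprD mulrCA mulVf ?mulr1 ?expf_neq0 ?gt_eqF//.
  rewrite ger0_norm ?exprn_ge0 ?(ltW y0)//.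
  rewrite -(@prednK (c z - K)) ?subn_gt0// exprS.
  rewrite (@le_trans _ _ y)// ?ge_min ?lexx//.
  by rewrite ler_piMr ?(ltW y0)// exprn_ile1 ?(ltW y0).
- by rewrite mulr1 add0r cK mulrCA mulVf ?expf_neq0 ?gt_eqF// mulr1 subrr normr0 ltW.
Qed.

End functionals.

Section pgf_functionals.
Variables (R : realType) (d : nat).

Definition monomial (x : 'rV[R]_d) (k : 'rV[nat]_d) : R :=
  \prod_(i < d) x 0 i ^+ k 0 i.

Definition in_cube (x : 'rV[R]_d) := forall i, 0 <= x 0 i <= 1.

Lemma monomial_ge0 x k : in_cube x -> 0 <= monomial x k.
Proof. by move=> x01; apply: prodr_ge0 => i _; rewrite exprn_ge0//; case/andP: (x01 i). Qed.

Lemma monomial_le1 x k : in_cube x -> monomial x k <= 1.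
Proof.
move=> x01; rewrite /monomial prodr_ile1// => i _.
by case/andP: (x01 i) => ? ?; rewrite exprn_ge0 ?exprn_ile1.
Qed.

Variables (Ln : nat -> ('rV[nat]_d -> R) -> R) (L0 : ('rV[nat]_d -> R) -> R).
Hypothesis hLn : forall n, subunit_functional (Ln n).
Hypothesis hL0 : subunit_functional L0.

(** The powers [x_i ^ z_i] are exchanged for the indicators of [z_i = k_i], one
    coordinate after the other. *)
Lemma functional_cvg_point :
  (forall x, in_cube x -> functional_cvg Ln L0 (monomial x)) ->
  forall k, functional_cvg Ln L0 (fun z : 'rV[nat]_d => (z == k)%:R).
Proof.
move=> H k.
(* The first r coordinates have already been exchanged. *)
pose mixed r (x : 'rV[R]_d) (z : 'rV[nat]_d) : R := \prod_(i < d)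
  (if (i < r)%N then (z 0 i == k 0 i)%:R else x 0 i ^+ z 0 i).
suff Hmix r : (r <= d)%N -> forall x, in_cube x -> functional_cvg Ln L0 (mixed r x).
  have := Hmix d (leqnn d) 0.
  rewrite (_ : mixed d 0 = fun z => (z == k)%:R).
    by apply => i; rewrite mxE lexx ler01.
  apply/funext => z; rewrite /mixed; have [->|/eqP zk] := eqVneq z k.
    by rewrite big1// => i _; rewrite ltn_ord eqxx.
  have [i zi] : exists i, z 0 i != k 0 i.
    by apply/existsP; rewrite -negb_forall; apply/negP => /forallP h;
      apply: zk; apply/rowP => i; exact/eqP.
  by rewrite (bigD1 i)//= ltn_ord (negPf zi) mul0r.
elim: r => [|r IH] rd x x01.
  rewrite (_ : mixed 0%N x = monomial x); first exact: H.
  by apply/funext => z.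
pose i0 := Ordinal rd.
pose g (z : 'rV[nat]_d) : R := \prod_(i < d | i != i0)
  (if (i < r)%N then (z 0 i == k 0 i)%:R else x 0 i ^+ z 0 i).
rewrite (_ : mixed r.+1 x = fun z : 'rV[nat]_d => g z * (z 0 i0 == k 0 i0)%:R); last first.
  apply/funext => z; rewrite /mixed (bigD1 i0)//= ltnSn mulrC; congr (_ * _).
  apply: eq_bigr => i ii0; rewrite ltnS leq_eqVlt -[_ == r]/(val i == val i0).
  by rewrite -(negbK (val i == _)) ii0.
apply: (@functional_cvg_index _ _ _ _ hLn hL0 g (fun z : 'rV[nat]_d => z 0 i0)).
  move=> z; rewrite /g normr_prod prodr_ile1// => i _; rewrite normr_ge0/=.
  case: ifP => _; first by case: eqP; rewrite ?normr1 ?normr0.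
  by have /andP[? ?] := x01 i; rewrite ger0_norm ?exprn_ge0// exprn_ile1.
move=> y y01.
rewrite (_ : (fun z => _) = mixed r (\row_i if i == i0 then y else x 0 i)).
  by apply: IH (ltnW rd) _ _ => i; rewrite mxE; case: ifP.
apply/funext => z; rewrite /mixed (bigD1 i0)//= ltnn mxE eqxx mulrC; congr (_ * _).
by apply: eq_bigr => i /negPf ii0; rewrite mxE ii0.
Qed.

End pgf_functionals.

(** * Lattice-valued random variables and independence *)

Section lattice_valued_variables.
Context d0 (T : measurableType d0) (R : realType) (P : probability T R).
Variable d : nat.
Implicit Types (U V W : T -> R) (X : T -> 'rV[nat]_d).

Lemma measurable_lattice d1 (T1 : measurableType d1) (g : 'rV[nat]_d -> T1) :
  measurable_fun setT g.
Proof. by move=> _ A _; rewrite setTI. Qed.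

(** Generating functions only involve functions with values between 0 and 1; this
    class is closed under products and free of integrability questions. *)
Definition unit_mfun U := measurable_fun setT U /\ forall w, 0 <= U w <= 1.

Lemma unit_mfun_comp X (g : 'rV[nat]_d -> R) : measurable_fun setT X ->
  (forall k, 0 <= g k <= 1) -> unit_mfun (fun w => g (X w)).
Proof.
move=> mX g01; split=> [|w]; last exact: g01.
by apply: measurableT_comp => //; exact: measurable_lattice.
Qed.

Lemma unit_mfunM U V : unit_mfun U -> unit_mfun V -> unit_mfun (fun w => U w * V w).
Proof.
move=> [mU U01] [mV V01]; split=> [|w]; first exact: measurable_funM.
by have /andP[? ?] := U01 w; have /andP[? ?] := V01 w; rewrite mulr_ge0//= mulr_ile1.
Qed.

Lemma unit_mfun_cst (c : R) : 0 <= c <= 1 -> unit_mfun (cst c).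
Proof. by move=> c01; split. Qed.

Lemma unit_mfun_prod (I : eqType) (s : seq I) (F : I -> T -> R) :
  (forall i, i \in s -> unit_mfun (F i)) -> unit_mfun (fun w => \prod_(i <- s) F i w).
Proof.
move=> hF; split=> [|w]; first by apply: measurable_prod => i /hF[].
elim: s hF => [|i s IH] hF; first by rewrite big_nil ler01 lexx.
rewrite big_cons.
have /hF[_ /(_ w)/andP[? ?]] : i \in i :: s by rewrite mem_head.
have /IH/andP[? ?] : forall j, j \in s -> unit_mfun (F j).
  by move=> j js; apply: hF; rewrite inE js orbT.
by rewrite mulr_ge0//= mulr_ile1.
Qed.

Lemma bounded_integrable U (M : R) : measurable_fun setT U -> (forall w, `|U w| <= M) ->
  P.-integrable setT (EFin \o U).
Proof.
move=> mU UM; apply: measurable_bounded_integrable => //.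
  by rewrite (le_lt_trans (probability_le1 P measurableT))// ltry.
by exists M; split; [exact: num_real|move=> y My w _ /=; rewrite (le_trans (UM w))// ltW].
Qed.

Lemma unit_integrable U : unit_mfun U -> P.-integrable setT (EFin \o U).
Proof.
by move=> [mU U01]; apply: (@bounded_integrable _ 1) => // w;
   have /andP[? ?] := U01 w; rewrite ger0_norm.
Qed.

Lemma unit_integral_EFin U : unit_mfun U ->
  (\int[P]_w (U w)%:E)%E = (\int[P]_w U w)%:E.
Proof. by move=> hU; rewrite fineK//; apply: integrable_fin_num => //; exact: unit_integrable. Qed.

Lemma unit_integral_01 U : unit_mfun U -> 0 <= \int[P]_w U w <= 1.
Proof.
move=> hU; have [mU U01] := hU; apply/andP; split.
  by apply: Rintegral_ge0 => w _; case/andP: (U01 w).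
rewrite -lee_fin -unit_integral_EFin//.
apply: le_trans (probability_le1 P measurableT).
rewrite -[leRHS]mul1e -integral_cst//; apply: ge0_le_integral => //.
- by move=> w _; rewrite lee_fin; case/andP: (U01 w).
- exact/measurable_EFinP.
- by move=> w _; rewrite lee_fin; case/andP: (U01 w).
Qed.

Lemma unit_integralZl U c : unit_mfun U -> \int[P]_w (c * U w) = c * \int[P]_w U w.
Proof. by move=> hU; rewrite RintegralZl//; exact: unit_integrable. Qed.

Lemma expectationE (U : T -> R) : fine 'E_P[U] = \int[P]_w U w.
Proof. by rewrite unlock. Qed.

End lattice_valued_variables.

Lemma lattice_preimage_measurable d0 (T : measurableType d0) d (X : T -> 'rV[nat]_d)
  (A : set 'rV[nat]_d) : measurable_fun setT X -> measurable (X @^-1` A).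
Proof. by move=> mX; rewrite -[_ @^-1` _]setTI; exact: mX. Qed.

Lemma unit_indicator d1 (T1 : measurableType d1) (R : realType) d (Z : T1 -> 'rV[nat]_d) l :
  measurable_fun setT Z -> unit_mfun (fun w => (Z w == l)%:R : R).
Proof.
move=> mZ; apply: (unit_mfun_comp (g := fun k => (k == l)%:R)) => // k.
by case: (k == l); rewrite lexx ler01.
Qed.

Section levels.
Context d1 (T1 : measurableType d1) d2 (T2 : measurableType d2) (R : realType).
Context (P1 : probability T1 R) (P2 : probability T2 R).
Variable d : nat.

Lemma integral_levels d0 (T : measurableType d0) (P : probability T R)
    (X : T -> 'rV[nat]_d) (U : T -> R) :
  measurable_fun setT X -> unit_mfun U ->
  (\int[P]_w (U w)%:E = \sum_(0 <= n <oo)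
    oapp (fun l => (\int[P]_w ((X w == l)%:R * U w))%:E) 0 (pickle_inv n))%E.
Proof.
move=> mX hU; have [mU U01] := hU.
pose F n : set T := if pickle_inv n is Some l then X @^-1` [set l] else set0.
have mF n : measurable (F n).
  by rewrite /F; case: pickle_inv => // l; exact: lattice_preimage_measurable.
have UF : \bigcup_n F n = setT.
  by apply/seteqP; split=> // w _; exists (choice.pickle (X w)) => //; rewrite /F pickleK_inv.
rewrite -[in LHS]UF ge0_integral_bigcup//.
- apply: eq_eseriesr => n _; rewrite /F.
  case: pickle_inv => /= [l|]; last by rewrite integral_set0.
  rewrite -unit_integral_EFin; last by apply: unit_mfunM => //; exact: unit_indicator.
  rewrite integral_mkcond; apply: eq_integral => w _; rewrite patchE.
  case: eqP => [<-|Xl]; first by rewrite mem_set//= mul1r.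
  by rewrite memNset ?mul0r.
- by rewrite UF; exact/measurable_EFinP.
- by move=> w _; rewrite lee_fin; case/andP: (U01 w).
- apply/trivIsetP => i j _ _ ij; apply/seteqP; split=> // w [].
  rewrite /F; case Ei: (pickle_inv i) => [l|//]; case Ej: (pickle_inv j) => [k|//].
  move=> /= Xl Xk; have := @pickle_invK 'rV[nat]_d i; have := @pickle_invK 'rV[nat]_d j.
  by rewrite Ei Ej/= -Xl -Xk => ji ii; move: ij; rewrite -{1}ii -{1}ji eqxx.
Qed.

(** The levels of a lattice-valued map form a countable partition, so that an
    integral is determined by its parts on the levels. Allowing two probability
    spaces makes it a tool to compare laws as well as to condition on the value of
    a random variable. *)
Lemma eq_integral_levels (X : T1 -> 'rV[nat]_d) (Y : T2 -> 'rV[nat]_d)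
    (U : T1 -> R) (V : T2 -> R) :
  measurable_fun setT X -> measurable_fun setT Y -> unit_mfun U -> unit_mfun V ->
  (forall l, \int[P1]_w ((X w == l)%:R * U w) = \int[P2]_w ((Y w == l)%:R * V w)) ->
  \int[P1]_w U w = \int[P2]_w V w.
Proof.
move=> mX mY hU hV UV; congr fine.
rewrite (integral_levels P1 mX hU) (integral_levels P2 mY hV).
by apply: eq_eseriesr => n _; case: pickle_inv => //= l; rewrite UV.
Qed.

End levels.

Section subunit.
Context d0 (T : measurableType d0) (R : realType) (P : probability T R).
Variables (d : nat) (X : T -> 'rV[nat]_d) (W : T -> R).
Hypotheses (mX : measurable_fun setT X) (hW : unit_mfun W).

Lemma subunit_expectation :
  subunit_functional (fun g => \int[P]_w (g (X w) * W w)).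
Proof.
have mg g : measurable_fun setT (fun w => g (X w) * W w).
  apply: measurable_funM; last exact: hW.1.
  by apply: measurableT_comp => //; exact: measurable_lattice.
have le g (M : R) : (forall z, `|g z| <= M) -> forall w, `|g (X w) * W w| <= M.
  move=> gM w; have /andP[W0 W1] := hW.2 w.
  by rewrite normrM (ger0_norm W0) (le_trans (ler_piMr _ W1)).
split=> [a g h [M gM] [M' hM']|g M gM].
  under eq_Rintegral do rewrite mulrDl -mulrA.
  have ig : P.-integrable setT (EFin \o (fun w => g (X w) * W w)).
    by apply: (@bounded_integrable _ _ _ _ _ M) => //; exact: le.
  have ih : P.-integrable setT (EFin \o (fun w => h (X w) * W w)).
    by apply: (@bounded_integrable _ _ _ _ _ M') => //; exact: le.
  rewrite RintegralD//; first by rewrite RintegralZl.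
  by have := integrableZl measurableT a ig; apply: eq_integrable.
have ig : P.-integrable setT (EFin \o (fun w => g (X w) * W w)).
  by apply: (@bounded_integrable _ _ _ _ _ M) => //; exact: le.
rewrite (le_trans (le_normr_Rintegral _ _))//.
rewrite (@le_trans _ _ (\int[P]_w M))//; last first.
  have PT : M * fine (P setT) = M by rewrite probability_setT mulr1.
  by rewrite Rintegral_cst// le_eqVlt; apply/predU1P; left; exact: PT.
apply: le_Rintegral => //; last by move=> w _; exact: le.
- have := integrable_norm ig; apply: eq_integrable => //.
- exact: finite_measure_integrable_cst.
Qed.

End subunit.

Section independence.
Context d0 (T : measurableType d0) (R : realType) (P : probability T R).
Variables (d : nat) (I : choiceType) (D : set I) (Y : I -> {RV P >-> 'rV[nat]_d}).
Hypothesis indep : mutually_independent D Y.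

Let mY i : measurable_fun setT (Y i). Proof. by []. Qed.

Lemma independent_point (s : seq I) (l : I -> 'rV[nat]_d) :
  uniq s -> (forall i, i \in s -> D i) ->
  \int[P]_w (\prod_(i <- s) (Y i w == l i)%:R) =
  \prod_(i <- s) \int[P]_w (Y i w == l i)%:R.
Proof.
move=> us sD.
have int1 (A : set T) (f : T -> bool) : measurable A -> (forall w, f w <-> A w) ->
    (\int[P]_w ((f w)%:R)%:E = P A)%E.
  move=> mA fA; rewrite -[X in _ = P X]setIT -integral_indic//; apply: eq_integral => w _.
  rewrite indicE; suff -> : f w = (w \in A) by []; apply/idP/idP => [/fA ?|]; first exact/mem_set.
  by move/set_mem/fA.
have mA i : measurable (Y i @^-1` [set l i]) by exact: lattice_preimage_measurable.
have mcap : measurable (\bigcap_(i in [set` [fset x in s]%fset]) Y i @^-1` [set l i]).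
  by apply: fin_bigcap_measurable => //; exact: finite_fset.
have E : P (\bigcap_(i in [set` [fset x in s]%fset]) Y i @^-1` [set l i]) =
    (\prod_(i <- [fset x in s]%fset) P (Y i @^-1` [set l i]))%E.
  by apply: (indep (A := fun i => [set l i])) => // i /=; rewrite in_fset => /sD.
move: E.
have -> : (\prod_(i <- [fset x in s]%fset) P (Y i @^-1` [set l i]) =
    \prod_(i <- s) P (Y i @^-1` [set l i]))%E.
  apply: perm_big; apply: uniq_perm => //.
  by move=> i; rewrite in_fset.
move=> E.
have E1 i : (P (Y i @^-1` [set l i]) = (\int[P]_w (Y i w == l i)%:R)%:E)%E.
  rewrite -unit_integral_EFin; last exact: unit_indicator.
  by rewrite (int1 (Y i @^-1` [set l i]))// => w; split=> /eqP.
apply: EFin_inj; rewrite -unit_integral_EFin; last first.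
  by apply: unit_mfun_prod => i _; exact: unit_indicator.
rewrite -prodEFin; under eq_bigr do rewrite -E1.
rewrite -E -(int1 _ (fun w => all (fun i => Y i w == l i) s) mcap).
  apply: eq_integral => w _; congr EFin; elim: (s) => [|i s' IH]; first by rewrite big_nil.
  by rewrite big_cons IH /=; case: eqP => _; rewrite ?mul1r ?mul0r.
move=> w; split=> [/allP h i /=|h].
  by rewrite in_fset => /h/eqP.
by apply/allP => i si; apply/eqP; apply: h; rewrite /= in_fset.
Qed.

(** Induction on [s]: conditioning on the value of one variable moves it from the
    list [s] of arbitrary functions to the list [t] of point indicators, to which
    the definition of independence applies. *)
Lemma independent_expectation_point (s t : seq I) (g : I -> 'rV[nat]_d -> R)
    (l : I -> 'rV[nat]_d) :
  uniq (s ++ t) -> (forall i, i \in s ++ t -> D i) ->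
  (forall i k, 0 <= g i k <= 1) ->
  \int[P]_w (\prod_(i <- s) g i (Y i w) * \prod_(i <- t) (Y i w == l i)%:R) =
  \prod_(i <- s) (\int[P]_w g i (Y i w)) * \prod_(i <- t) \int[P]_w (Y i w == l i)%:R.
Proof.
move=> + + g01; elim: s t l => [|i s IH] t l ust stD.
  under eq_Rintegral do rewrite big_nil mul1r.
  by rewrite big_nil mul1r independent_point.
set W := fun w => \prod_(j <- s) g j (Y j w) * \prod_(j <- t) (Y j w == l j)%:R.
have hW : unit_mfun W.
  apply: unit_mfunM; apply: unit_mfun_prod => j _; last exact: unit_indicator.
  exact: unit_mfun_comp.
set c := \prod_(j <- s) (\int[P]_w g j (Y j w)) * \prod_(j <- t) \int[P]_w (Y j w == l j)%:R.
have hg : unit_mfun (fun w => g i (Y i w)) by exact: unit_mfun_comp.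
have Wc : \int[P]_w W w = c.
  apply: IH; first by case/andP: ust.
  by move=> j js; apply: stD; rewrite /= inE js orbT.
have hc : 0 <= c <= 1 by rewrite -Wc; exact: unit_integral_01.
transitivity (\int[P]_w (g i (Y i w) * c)); last first.
  rewrite big_cons -mulrA -/c mulrC -unit_integralZl//.
  by apply: eq_Rintegral => w _; rewrite mulrC.
transitivity (\int[P]_w (g i (Y i w) * W w)).
  by apply: eq_Rintegral => w _; rewrite big_cons mulrA.
apply: (eq_integral_levels (X := Y i) (Y := Y i)) => //.
- exact: unit_mfunM.
- by apply: unit_mfunM => //; exact: unit_mfun_cst.
move=> k.
have E (V : T -> R) : \int[P]_w ((Y i w == k)%:R * (g i (Y i w) * V w)) =
    \int[P]_w (g i k * ((Y i w == k)%:R * V w)).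
  by apply: eq_Rintegral => w _; case: eqP => [->|_]; rewrite ?mul1r// !mul0r mulr0.
have hk : unit_mfun (fun w => (Y i w == k)%:R : R) by exact: unit_indicator.
rewrite !E !unit_integralZl//; first last.
- exact: unit_mfunM.
- by apply: unit_mfunM => //; exact: unit_mfun_cst.
congr (_ * _).
transitivity (c * \int[P]_w (Y i w == k)%:R); last first.
  by rewrite -unit_integralZl//; apply: eq_Rintegral => w _; rewrite mulrC.
have ui : i \notin s ++ t by case/andP: ust.
pose l' j := if j == i then k else l j.
have lt j : j \in s ++ t -> l' j = l j.
  by move=> jst; rewrite /l'; case: eqP => // ji; rewrite -ji jst in ui.
have El (F : I -> 'rV[nat]_d -> R) :
    \prod_(j <- i :: t) F j (l' j) = F i k * \prod_(j <- t) F j (l j).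
  rewrite big_cons /l' eqxx; congr (_ * _); rewrite !big_seq.
  by apply: eq_bigr => j jt; rewrite -/(l' j) lt// mem_cat jt orbT.
have := IH (i :: t) l'; rewrite (El (fun j z => \int[P]_w (Y j w == z)%:R)).
under eq_Rintegral do rewrite (El (fun j z => (Y j _ == z)%:R)).
move=> H; rewrite /c mulrC mulrCA -H.
- by apply: eq_Rintegral => w _; rewrite /W mulrCA.
- by rewrite -cat1s uniq_catCA cat1s.
- by move=> j; rewrite mem_cat inE orbCA -mem_cat => jst; apply: stD; rewrite /= inE.
Qed.

Lemma independent_expectation (s : seq I) (g : I -> 'rV[nat]_d -> R) :
  uniq s -> (forall i, i \in s -> D i) -> (forall i k, 0 <= g i k <= 1) ->
  \int[P]_w (\prod_(i <- s) g i (Y i w)) = \prod_(i <- s) \int[P]_w g i (Y i w).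
Proof.
move=> us sD g01.
have := @independent_expectation_point s [::] g (fun=> 0).
rewrite cats0 big_nil mulr1 => <-//.
by apply: eq_Rintegral => w _; rewrite big_nil mulr1.
Qed.

End independence.

(** * Generating functions of the branching process *)

Section lattice_laws.
Context d0 (T : measurableType d0) (R : realType) (P : probability T R).
Variable d : nat.
Implicit Types (X : T -> 'rV[nat]_d) (k l : 'rV[nat]_d) (x : 'rV[R]_d).

Definition pgf X (x : 'rV[R]_d) : R := \int[P]_w monomial x (X w).

Lemma unit_monomial X x : measurable_fun setT X -> in_cube x ->
  unit_mfun (fun w => monomial x (X w)).
Proof.
move=> mX x01; apply: unit_mfun_comp => // k.
by rewrite monomial_ge0 ?monomial_le1.
Qed.

Lemma pgf_01 X x : measurable_fun setT X -> in_cube x -> 0 <= pgf X x <= 1.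
Proof. by move=> mX x01; apply: unit_integral_01; exact: unit_monomial. Qed.

Lemma integral_point X l : measurable_fun setT X ->
  \int[P]_w (X w == l)%:R = fine (P (X @^-1` [set l])).
Proof.
move=> mX; congr fine; rewrite -[X in _ = P X]setIT -integral_indic//; last first.
  exact: lattice_preimage_measurable.
apply: eq_integral => w _; rewrite indicE.
suff -> : (X w == l) = (w \in X @^-1` [set l]) by [].
by apply/eqP/idP => [Xl|/set_mem//]; exact: mem_set.
Qed.

Lemma integral_point_comp X l (h : 'rV[nat]_d -> R) (W : T -> R) :
  \int[P]_w ((X w == l)%:R * (h (X w) * W w)) = \int[P]_w (h l * ((X w == l)%:R * W w)).
Proof. by apply: eq_Rintegral => w _; case: eqP => [->|_]; rewrite ?mul1r// !mul0r mulr0. Qed.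

Lemma monomialD x k l : monomial x (k + l) = monomial x k * monomial x l.
Proof. by rewrite /monomial -big_split/=; apply: eq_bigr => i _; rewrite mxE exprD. Qed.

Lemma monomial0 x : monomial x 0 = 1 :> R.
Proof. by rewrite /monomial big1// => i _; rewrite mxE expr0. Qed.

Lemma monomial_sum x (I : Type) (s : seq I) (F : I -> 'rV[nat]_d) :
  monomial x (\sum_(i <- s) F i) = \prod_(i <- s) monomial x (F i) :> R.
Proof. exact: (big_morph _ (monomialD x) (monomial0 x)). Qed.

End lattice_laws.

Section gwi_generating_function.
Context d0 (T : measurableType d0) (R : realType) (P : probability T R).
Variables (d : nat) (xi : nat -> nat -> 'I_d -> {RV P >-> 'rV[nat]_d}).
Variables (eps X : nat -> {RV P >-> 'rV[nat]_d}).
Hypothesis hX : is_gwi xi eps X.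

Let Y := gwi_family xi eps.

Local Notation label := ((nat * nat * 'I_d) + nat)%type.

Definition generation (s : label) : nat :=
  match s with inl (n, _, _) => n | inr n => n end.

Definition later (n : nat) (s : label) : Prop :=
  gwi_index s /\ (n < generation s)%N.

Lemma pgf_offspring_ident n j i x : (0 < n)%N -> (0 < j)%N -> in_cube x ->
  pgf P (xi n j i) x = pgf P (xi n 1%N i) x.
Proof.
move=> n0 j0 x01; apply: (eq_integral_levels (X := xi n j i) (Y := xi n 1%N i)) => //;
  try exact: unit_monomial.
move=> l; have E k : \int[P]_w ((xi n k i w == l)%:R * monomial x (xi n k i w)) =
    monomial x l * fine (distribution P (xi n k i) [set l]).
  rewrite -[fine _]/(fine (P (xi n k i @^-1` [set l]))) -integral_point//.
  rewrite -unit_integralZl; last exact: unit_indicator.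
  by apply: eq_Rintegral => w _; case: eqP => [->|_]; rewrite ?mul1r ?mulr1// mul0r mulr0.
by rewrite !E (gwi_ident hX).
Qed.

(** Independence of generation [n] from the later vectors, in the form in which it is
    used: finitely many later vectors suffice once the value of [X n] is fixed. *)
Definition factorizes n := forall (s : seq label) (g : label -> 'rV[nat]_d -> R),
  uniq s -> (forall i, i \in s -> later n i) -> (forall i k, 0 <= g i k <= 1) ->
  forall l, \int[P]_w ((X n w == l)%:R * \prod_(i <- s) g i (Y i w)) =
    \int[P]_w (X n w == l)%:R * \prod_(i <- s) \int[P]_w g i (Y i w).

Definition offspring_point n x : 'rV[R]_d := \row_i pgf P (xi n 1%N i) x.

Lemma offspring_point_cube n x : in_cube x -> in_cube (offspring_point n x).
Proof. by move=> x01 i; rewrite mxE; exact: pgf_01. Qed.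

(** Conditionally on [X n = l], generation [n + 1] is the sum of finitely many
    offspring and immigration vectors, and its monomial is the product of theirs.
    The weights [g] on later generations are carried along for the induction. *)
Lemma gwi_step_pgf n (s : seq label) (g : label -> 'rV[nat]_d -> R) x :
  factorizes n ->
  uniq s -> (forall i, i \in s -> later n.+1 i) -> (forall i k, 0 <= g i k <= 1) ->
  in_cube x ->
  \int[P]_w (monomial x (X n.+1 w) * \prod_(i <- s) g i (Y i w)) =
    pgf P (X n) (offspring_point n.+1 x) * pgf P (eps n.+1) x *
    \prod_(i <- s) \int[P]_w g i (Y i w).
Proof.
move=> fac us sl g01 x01.
set c := \prod_(i <- s) \int[P]_w g i (Y i w).
have unitg i : unit_mfun (fun w => g i (Y i w)) by exact: unit_mfun_comp.
have hW : unit_mfun (fun w => \prod_(i <- s) g i (Y i w)).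
  by apply: unit_mfun_prod => i _.
have c01 : 0 <= pgf P (eps n.+1) x * c <= 1.
  have /andP[? ?] := pgf_01 P (X := eps n.+1) (measurable_funP _) x01.
  have /andP[? ?] : 0 <= c <= 1.
    apply/andP; split; first by apply: prodr_ge0 => i _; case/andP: (unit_integral_01 P (unitg i)).
    by apply: prodr_ile1 => i _; exact: unit_integral_01.
  by rewrite mulr_ge0//= mulr_ile1.
have hG := offspring_point_cube n.+1 x01.
transitivity (\int[P]_w (monomial (offspring_point n.+1 x) (X n w) *
    (pgf P (eps n.+1) x * c))); last first.
  rewrite -mulrA [RHS]mulrC -unit_integralZl; last exact: unit_monomial.
  by apply: eq_Rintegral => w _; rewrite mulrC.
apply: (eq_integral_levels (X := X n) (Y := X n)) => //.
- by apply: unit_mfunM => //; exact: unit_monomial.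
- by apply: unit_mfunM; [exact: unit_monomial|exact: unit_mfun_cst].
move=> l; rewrite integral_point_comp.
rewrite unit_integralZl; last by apply: unit_mfunM; [exact: unit_indicator|exact: unit_mfun_cst].
have -> : \int[P]_w ((X n w == l)%:R * (pgf P (eps n.+1) x * c)) =
    \int[P]_w (X n w == l)%:R * (pgf P (eps n.+1) x * c).
  rewrite [RHS]mulrC -[RHS]unit_integralZl; last exact: unit_indicator.
  by apply: eq_Rintegral => w _; rewrite mulrC.
(* The individuals born in generation n + 1 when generation n equals l. *)
pose J : seq label :=
  [seq inl (n.+1, j, i) | i <- enum 'I_d, j <- iota 1 (l 0 i)].
pose g' i : 'rV[nat]_d -> R := if (n.+1 < generation i)%N then g i else monomial x.
have Jgen i : i \in J -> gwi_index i /\ generation i = n.+1.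
  by move=> /allpairsPdep[a [b [_ + ->]]]; rewrite mem_iota => /andP[b0 _].
have sgen i : i \in s -> gwi_index i /\ (n.+1 < generation i)%N by exact: sl.
have g'01 i k : 0 <= g' i k <= 1.
  by rewrite /g'; case: ifP => // _; rewrite monomial_ge0 ?monomial_le1.
have := fac (inr n.+1 :: J ++ s) g' _ _ g'01 l.
have prodE (F : label -> ('rV[nat]_d -> R) -> R) :
    \prod_(i <- inr n.+1 :: J ++ s) F i (g' i) =
    F (inr n.+1) (monomial x) * ((\prod_(i <- J) F i (monomial x)) * \prod_(i <- s) F i (g i)).
  rewrite big_cons big_cat/= /g'/= ltnn; congr (_ * (_ * _)); rewrite !big_seq;
  apply: eq_bigr => i.
    by move=> /Jgen[_ ->]; rewrite ltnn.
  by move=> /sgen[_ ->].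
rewrite (prodE (fun i h => \int[P]_w h (Y i w))).
under eq_Rintegral do rewrite (prodE (fun i h => h (Y i _))).
move=> H; transitivity (\int[P]_w (X n w == l)%:R *
    (pgf P (eps n.+1) x * (monomial (offspring_point n.+1 x) l * c))); last by ring.
have -> : monomial (offspring_point n.+1 x) l = \prod_(i <- J) \int[P]_w monomial x (Y i w).
  rewrite /J big_allpairs_dep/= big_enum/=; apply: eq_bigr => i _.
  rewrite mxE (eq_big_seq (fun=> pgf P (xi n.+1 1%N i) x)).
    by rewrite big_const_seq count_predT size_iota iter_mulr_1.
  move=> j; rewrite mem_iota => /andP[j0 _].
  exact: pgf_offspring_ident.
rewrite -H.
- apply: eq_Rintegral => w _; case: eqP => [Xl|_]; last by rewrite !mul0r.
  rewrite !mul1r mulrA; congr (_ * _).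
  rewrite (gwi_step hX)//= monomialD mulrC; congr (_ * _).
  rewrite /J big_allpairs_dep/= big_enum/= monomial_sum; apply: eq_bigr => i _.
  by rewrite monomial_sum Xl /index_iota subn1.
- rewrite cons_uniq cat_uniq us andbT mem_cat negb_or; apply/and3P; split.
  + apply/andP; split; first by apply/negP => /allpairsPdep[a [b []]].
    by apply/negP => /sgen[_]; rewrite ltnn.
  + apply: allpairs_uniq_dep; first exact: enum_uniq.
      by move=> i _; exact: iota_uniq.
    by move=> [a b] [a' b'] _ _ /= [-> ->].
  + by apply/hasPn => i /sgen[_ ig]; apply/negP => /Jgen[_ E]; rewrite E ltnn in ig.
- move=> i; rewrite inE mem_cat => /or3P[/eqP ->|/Jgen[iD E]|/sgen[iD E]]; split => //=.
  + by rewrite E.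
  + exact: ltnW.
Qed.

(** Both sides are functionals of the indicator of [X n = l]; they agree on
    monomials, hence on points. *)
Lemma factorizes_of_pgf n :
  (forall (s : seq label) (g : label -> 'rV[nat]_d -> R) x, uniq s ->
    (forall i, i \in s -> later n i) -> (forall i k, 0 <= g i k <= 1) ->
    in_cube x ->
    \int[P]_w (monomial x (X n w) * \prod_(i <- s) g i (Y i w)) =
    pgf P (X n) x * \prod_(i <- s) \int[P]_w g i (Y i w)) -> factorizes n.
Proof.
move=> H s g us sl g01 l.
have unitg i : unit_mfun (fun w => g i (Y i w)) by exact: unit_mfun_comp.
set W := fun w => \prod_(i <- s) g i (Y i w).
have hW : unit_mfun W by apply: unit_mfun_prod => i _.
set c := \prod_(i <- s) _.
have c01 : 0 <= c <= 1.
  apply/andP; split; first by apply: prodr_ge0 => i _; case/andP: (unit_integral_01 P (unitg i)).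
  by apply: prodr_ile1 => i _; exact: unit_integral_01.
have Ec (h : 'rV[nat]_d -> R) : (forall k, 0 <= h k <= 1) ->
    \int[P]_w (h (X n w) * c) = \int[P]_w h (X n w) * c.
  move=> h01; rewrite mulrC -unit_integralZl; last exact: unit_mfun_comp.
  by apply: eq_Rintegral => w _; rewrite mulrC.
rewrite -(Ec (fun k => (k == l)%:R)); last by move=> k; case: (k == l); rewrite lexx ler01.
(* A constant sequence converges to its limit, so the two functionals agree. *)
have K : functional_cvg (fun _ h => \int[P]_w (h (X n w) * W w))
    (fun h => \int[P]_w (h (X n w) * c)) (fun k => (k == l)%:R).
  apply: functional_cvg_point => [_||x x01].
  - exact: subunit_expectation.
  - by apply: subunit_expectation => //; exact: unit_mfun_cst.
  - rewrite /functional_cvg (Ec (monomial x)); last first.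
      by move=> k; rewrite monomial_ge0 ?monomial_le1.
    by rewrite (H s g x)//; exact: cvg_cst.
by rewrite -(cvg_lim (@Rhausdorff R) K) lim_cst//; exact: Rhausdorff.
Qed.

Lemma gwi_pgf_recE n x : factorizes n -> in_cube x ->
  pgf P (X n.+1) x = pgf P (X n) (offspring_point n.+1 x) * pgf P (eps n.+1) x.
Proof.
move=> fac x01.
have := gwi_step_pgf (s := [::]) (g := fun _ _ => 1) fac isT _ _ x01.
rewrite !big_nil mulr1 => <-//; last by move=> *; rewrite ler01 lexx.
by apply: eq_Rintegral => w _; rewrite mulr1.
Qed.

Lemma gwi_factorizes n : factorizes n.
Proof.
elim: n => [|n IH].
  move=> s g us sl g01 l.
  have E (V : T -> R) : \int[P]_w ((X 0%N w == l)%:R * V w) = \int[P]_w ((0 == l)%:R * V w).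
    by apply: eq_Rintegral => w _; rewrite (gwi_init hX).
  rewrite E; have unitg i : unit_mfun (fun w => g i (Y i w)) by exact: unit_mfun_comp.
  rewrite unit_integralZl; last by apply: unit_mfun_prod => i _.
  rewrite (independent_expectation (gwi_indep hX))//; last by move=> i /sl[].
  congr (_ * _); have := E (fun=> 1); under eq_Rintegral do rewrite mulr1.
  move=> ->; rewrite unit_integralZl; last by apply: (@unit_mfun_cst _ _ _ 1); rewrite ler01 lexx.
  have PT : (1 : R) * fine (P setT) = 1 by rewrite probability_setT mulr1.
  by rewrite Rintegral_cst// -[LHS]mulr1; congr (_ * _); rewrite -[LHS]PT.
apply: factorizes_of_pgf => s g x us sl g01 x01.
rewrite gwi_step_pgf//; congr (_ * _).
by rewrite (gwi_pgf_recE IH x01).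
Qed.

Lemma gwi_pgf_rec n x : in_cube x ->
  pgf P (X n.+1) x = pgf P (X n) (offspring_point n.+1 x) * pgf P (eps n.+1) x.
Proof. exact/gwi_pgf_recE/gwi_factorizes. Qed.

End gwi_generating_function.

(** * Bernoulli and Poisson laws, and the continuity theorem *)

Section functionals_of_laws.
Variables (R : realType) (S : Type).
Implicit Types (L : (S -> R) -> R) (g h : S -> R).

Lemma subunit_sum L (I : Type) (s : seq I) (a : I -> R) (F : I -> S -> R) h :
  subunit_functional L -> (forall i, bounded_real (F i)) -> bounded_real h ->
  bounded_real (fun z => \sum_(i <- s) a i * F i z + h z) /\
  L (fun z => \sum_(i <- s) a i * F i z + h z) = \sum_(i <- s) a i * L (F i) + L h.
Proof.
move=> hL bF bh; elim: s => [|i s [IH1 IH2]].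
  rewrite (_ : (fun=> _) = h) ?big_nil ?add0r//.
  by apply/funext => z; rewrite big_nil add0r.
rewrite (_ : (fun=> _) =
    fun z => a i * F i z + (\sum_(j <- s) a j * F j z + h z)); last first.
  by apply/funext => z; rewrite big_cons addrA.
by split; [exact: bounded_real_lin|rewrite (proj1 hL)// IH2 big_cons addrA].
Qed.

(** A function with values between 0 and [2c] is within [c] of the constant [c], so
    its image is within [c] of [c]: positivity comes for free from the norm bound. *)
Lemma subunit_ge0 L h : subunit_functional L -> L (fun=> 1) = 1 ->
  bounded_real h -> (forall z, 0 <= h z) -> 0 <= L h.
Proof.
move=> [Llin Lle] L1 [M hM] h0.
have b1 : bounded_real (fun _ : S => 1 : R) by exists 1 => z; rewrite normr1.
have : `|L (fun z => - (`|M| / 2) * 1 + h z)| <= `|M| / 2.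
  apply: Lle => z; have := hM z; have := ler_norm M; have := h0 z.
  rewrite !ler_norml => ? ? /andP[? ?]; apply/andP; split; lra.
rewrite Llin//; last by exists M.
by rewrite L1 ler_norml => /andP[? _]; lra.
Qed.

Variables (Ln : nat -> (S -> R) -> R) (L0 : (S -> R) -> R).
Hypothesis hLn : forall n, subunit_functional (Ln n).
Hypothesis hL0 : subunit_functional L0.
Hypothesis Ln1 : forall n, Ln n (fun=> 1) = 1.
Hypothesis L01 : L0 (fun=> 1) = 1.

(** Mass that the limit puts on [chi m] cannot escape: since [L0 (chi m)] is close
    to 1, so is [Ln n (chi m)] eventually, and what a bounded function does off
    [chi m] is negligible uniformly in [n]. *)
Lemma functional_cvg_tight (chi : nat -> S -> R) g :
  (forall m z, 0 <= chi m z <= 1) ->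
  (forall e : R, 0 < e -> exists m, 1 - e <= L0 (chi m)) ->
  (forall m, functional_cvg Ln L0 (chi m)) ->
  (forall m, functional_cvg Ln L0 (fun z => g z * chi m z)) ->
  bounded_real g -> functional_cvg Ln L0 g.
Proof.
move=> chi01 chi1 cchi cg [M0 gM0].
pose M := `|M0|; have M_ge0 : 0 <= M by rewrite normr_ge0.
have gM z : `|g z| <= M by rewrite (le_trans (gM0 z))// ler_norm.
have b1 : bounded_real (fun _ : S => 1 : R) by exists 1 => z; rewrite normr1.
have bchi m : bounded_real (chi m).
  by exists 1 => z; have /andP[? ?] := chi01 m z; rewrite ger0_norm.
have bg : bounded_real g by exists M.
have bgchi m : bounded_real (fun z => g z * chi m z).
  exists M => z; have /andP[c0 c1] := chi01 m z.
  by rewrite normrM (ger0_norm c0) (le_trans (ler_piMr _ c1)).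
have tail L m : subunit_functional L -> L (fun=> 1) = 1 ->
    `|L g - L (fun z => g z * chi m z)| <= M * (1 - L (chi m)).
  move=> hL L1; have [Llin _] := hL.
  have bl : bounded_real (fun z => -1 * (g z * chi m z) + g z) by exact: bounded_real_lin.
  have bc : bounded_real (fun z => - M * chi m z + M * 1 + 0 : R).
    exists M => z; have /andP[? ?] := chi01 m z; rewrite ger0_norm; nra.
  have E1 : L (fun z => -1 * (g z * chi m z) + g z) = L g - L (fun z => g z * chi m z).
    by rewrite Llin// mulN1r addrC.
  have b0 : bounded_real (fun _ : S => 0 : R) by exact: bounded_real0.
  have L00 : L (fun=> 0) = 0.
    by have := proj2 hL (fun=> 0) 0 (fun z => _); rewrite normr0 => /(_ (fun=> lexx _));
       rewrite normr_le0 => /eqP.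
  have bM : bounded_real (fun _ : S => M * 1 + 0) by exact: bounded_real_lin.
  have E2 a : L (fun z => a * (-1 * (g z * chi m z) + g z) + (- M * chi m z + (M * 1 + 0))) =
      a * (L g - L (fun z => g z * chi m z)) + M * (1 - L (chi m)).
    rewrite Llin//; last exact: bounded_real_lin.
    by rewrite E1 !Llin// L1 L00; ring.
  have pos a : `|a| <= 1 -> 0 <= a * (L g - L (fun z => g z * chi m z)) + M * (1 - L (chi m)).
    move=> a1; rewrite -E2; apply: subunit_ge0 => //.
      by apply: bounded_real_lin => //; exact: bounded_real_lin.
    move=> z; have /andP[c0 c1] := chi01 m z.
    have := gM z; have : `|a * g z| <= M by rewrite normrM (le_trans (ler_piMl _ a1)).
    by rewrite !ler_norml => /andP[? ?] _; nra.
  rewrite ler_norml; have := pos 1; have := pos (-1); rewrite normrN normr1.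
  by move=> /(_ (lexx _)) ? /(_ (lexx _)) ?; apply/andP; split; lra.
apply/cvgrPdist_le => e e0.
pose dl := e / (3 * M + 1).
have M1 : 0 < 3 * M + 1 by rewrite ltr_wpDl// mulr_ge0.
have dl0 : 0 < dl by rewrite divr_gt0.
have eE : e = dl * (3 * M + 1) by rewrite /dl divfK// gt_eqF.
have [m hm] := chi1 _ dl0.
have h1 := (@cvgrPdist_le _ _ _ _ _ _ _).1 (cchi m) _ dl0.
have h2 := (@cvgrPdist_le _ _ _ _ _ _ _).1 (cg m) _ dl0.
near=> n.
have a1 : `|L0 (chi m) - Ln n (chi m)| <= dl by near: n; exact: h1.
have a2 : `|L0 (fun z => g z * chi m z) - Ln n (fun z => g z * chi m z)| <= dl by near: n; exact: h2.
have t0 := tail _ m hL0 L01; have tn := tail _ m (hLn n) (Ln1 n).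
have k0 : M * (1 - L0 (chi m)) <= M * dl by rewrite ler_wpM2l//; lra.
have kn : M * (1 - Ln n (chi m)) <= M * (2 * dl).
  by rewrite ler_wpM2l//; move: a1; rewrite ler_norml => /andP[? ?]; lra.
rewrite eE; move: a2 t0 tn k0 kn; rewrite !ler_norml.
by move=> /andP[? ?] /andP[? ?] /andP[? ?] ? ?; apply/andP; split; lra.
Unshelve. all: by end_near. Qed.

End functionals_of_laws.

Section bernoulli_law.
Context d0 (T : measurableType d0) (R : realType) (P : probability T R).
Variables (d : nat) (Z : {RV P >-> 'rV[nat]_d}) (p : 'rV[R]_d).
Hypothesis hZ : forall A, distribution P Z A = Be p A.

Let e (i : 'I_d) : 'rV[nat]_d := delta_mx 0 i.

Let e_inj i j : (e i == e j) = (i == j).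
Proof.
apply/eqP/eqP => [/matrixP/(_ 0 j)|->//].
by rewrite !mxE !eqxx/=; case: (j =P i) => [->|].
Qed.

Let e_neq0 i : (e i == 0) = false.
Proof. by apply/eqP => /matrixP/(_ 0 i); rewrite !mxE !eqxx. Qed.

Let mass l : \int[P]_w (Z w == l)%:R =
  \sum_(i < d) p 0 i * (e i == l)%:R + (1 - \sum_(i < d) p 0 i) * (0 == l)%:R.
Proof.
rewrite integral_point// -[P _]/(distribution P Z [set l]) hZ /Be.
have D k : (\d_k [set l] = ((k == l)%:R)%:E :> \bar R)%E.
  rewrite diracE; suff -> : (k \in [set l]) = (k == l) by [].
  by apply/idP/eqP => [/set_mem//|->]; exact/mem_set.
rewrite D -EFinM; under eq_bigr do rewrite D -EFinM.
by rewrite sumEFin.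
Qed.

Lemma bernoulli_ge0 i : 0 <= p 0 i.
Proof.
have : 0 <= \int[P]_w (Z w == e i)%:R by exact: Rintegral_ge0.
rewrite mass eq_sym e_neq0 mulr0 addr0 (bigD1 i)//= eqxx mulr1 big1 ?addr0// => j ji.
by rewrite e_inj (negPf ji) mulr0.
Qed.

(** The monomial agrees, on the support, with the indicator combination [v]. *)
Lemma pgf_bernoulli x : in_cube x ->
  pgf P Z x = 1 - \sum_(i < d) p 0 i * (1 - x 0 i).
Proof.
move=> x01.
pose v (k : 'rV[nat]_d) := \sum_(i < d) x 0 i * (k == e i)%:R + (k == 0)%:R : R.
have v0 : v 0 = 1.
  by rewrite /v eqxx big1 ?add0r// => i _; rewrite eq_sym e_neq0 mulr0.
have ve j : v (e j) = x 0 j.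
  rewrite /v e_neq0 addr0 (bigD1 j)//= eqxx mulr1 big1 ?addr0// => i ij.
  by rewrite e_inj eq_sym (negPf ij) mulr0.
have me j : monomial x (e j) = x 0 j.
  rewrite /monomial (bigD1 j)//= big1 => [|i ij]; first by rewrite mulr1 mxE !eqxx expr1.
  by rewrite mxE (negPf ij) andbF expr0.
have vother k : k != 0 -> (forall i, k != e i) -> v k = 0.
  move=> k0 ke; rewrite /v (negPf k0) addr0 big1// => i _.
  by rewrite (negPf (ke i)) mulr0.
have cases k : [\/ k = 0, exists i, k = e i | k != 0 /\ forall i, k != e i].
  have [->|k0] := eqVneq k 0; first by constructor 1.
  have [/existsP[i /eqP ->]|/existsPn h] := boolP [exists i, k == e i].
    by constructor 2; exists i.
  by constructor 3.
have v01 k : 0 <= v k <= 1.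
  case: (cases k) => [->|[i ->]|[k0 ke]]; rewrite ?v0 ?ve ?vother ?lexx ?ler01//.
have mZ : measurable_fun setT Z by [].
transitivity (\int[P]_w v (Z w)).
  apply: (eq_integral_levels (X := Z) (Y := Z)) => //; first exact: unit_monomial.
    exact: unit_mfun_comp.
  move=> l.
  have E (h : 'rV[nat]_d -> R) : \int[P]_w ((Z w == l)%:R * h (Z w)) =
      h l * \int[P]_w (Z w == l)%:R.
    rewrite -unit_integralZl; last exact: unit_indicator.
    by apply: eq_Rintegral => w _; case: eqP => [->|_]; rewrite ?mul1r ?mulr1// mul0r mulr0.
  rewrite !E; case: (cases l) => [->|[i ->]|[k0 ke]].
  - by rewrite v0 monomial0.
  - by rewrite ve me.
  - rewrite mass big1 => [|i _]; last by rewrite eq_sym (negPf (ke i)) mulr0.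
    by rewrite eq_sym (negPf k0) mulr0 add0r !mulr0.
have b (l : 'rV[nat]_d) : bounded_real (fun k => (k == l)%:R : R).
  by exists 1 => k; case: (k == l); rewrite ?normr1 ?normr0.
have u1 : unit_mfun (cst 1 : T -> R) by apply: unit_mfun_cst; rewrite ler01 lexx.
have [_] := subunit_sum (index_enum 'I_d) (fun i => x 0 i)
  (subunit_expectation P mZ u1) (fun i => b (e i)) (b 0).
move=> K.
transitivity (\int[P]_w (v (Z w) * 1)); first by apply: eq_Rintegral => w _; rewrite mulr1.
rewrite K /=.
under eq_bigr => i _.
  under eq_Rintegral do rewrite mulr1.
  rewrite mass eq_sym e_neq0 mulr0 addr0 (bigD1 i)//= eqxx mulr1 big1 ?addr0; last first.
    by move=> j ji; rewrite e_inj (negPf ji) mulr0.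
  over.
under eq_Rintegral do rewrite mulr1.
have -> : \int[P]_w (Z w == 0)%:R = 1 - \sum_(i < d) p 0 i.
  by rewrite mass eqxx mulr1 big1 ?add0r// => i _; rewrite e_neq0 mulr0.
under [in RHS]eq_bigr do rewrite mulrBr mulr1.
rewrite sumrB opprB addrCA; congr (1 + (_ - _)).
by apply: eq_bigr => i _; rewrite mulrC.
Qed.

End bernoulli_law.

Section poisson_law.
Variables (R : realType) (d : nat).

Lemma poisson_prob_point (r : R) n : 0 <= r ->
  poisson_prob r 0%N [set n] = (r ^+ n / n`!%:R * expR (- r))%:E.
Proof.
rewrite /poisson_prob le_eqVlt => /predU1P[<-|r0].
  rewrite ltxx diracE oppr0 expR0 mulr1; case: n => [|n].
    by rewrite mem_set// expr0 fact0 divr1.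
  by rewrite memNset// expr0n/= mul0r.
rewrite r0 esum_set1; last by rewrite lee_fin poisson_pmf_ge0.
by rewrite /poisson_pmf r0.
Qed.

Lemma Po_point (mu : 'rV[R]_d) l : (forall i, 0 <= mu 0 i) ->
  Po mu [set l] = (\prod_(i < d) (mu 0 i ^+ l 0 i / (l 0 i)`!%:R * expR (- mu 0 i)))%:E.
Proof.
move=> mu0; rewrite /Po/= /product_law esum_set1; last first.
  by apply: prode_ge0 => i _; exact: measure_ge0.
by rewrite -prodEFin; apply: eq_bigr => i _; exact: poisson_prob_point.
Qed.

(** Tilting: [x^k Po(mu){k} = exp (mu (x - 1)) Po(mu x){k}], and [Po(mu x)] has total
    mass 1, so no series has to be summed. *)
Lemma pgf_Po (mu x : 'rV[R]_d) : (forall i, 0 <= mu 0 i) -> in_cube x ->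
  \int[Po mu]_k monomial x k = expR (- \sum_(i < d) mu 0 i * (1 - x 0 i)).
Proof.
move=> mu0 x01; pose c := expR (- \sum_(i < d) mu 0 i * (1 - x 0 i)).
pose nu : 'rV[R]_d := \row_i (mu 0 i * x 0 i).
have nu0 i : 0 <= nu 0 i by rewrite mxE mulr_ge0//; case/andP: (x01 i).
have c01 : 0 <= c <= 1.
  rewrite expR_ge0/= -expR0 ler_expR oppr_le0 sumr_ge0// => i _.
  by rewrite mulr_ge0// subr_ge0; case/andP: (x01 i).
have mid : measurable_fun setT (@id 'rV[nat]_d) by [].
have PT : c * fine (Po nu setT) = c by rewrite probability_setT mulr1.
transitivity (\int[Po nu]_k c); last by rewrite Rintegral_cst//.
apply: (@eq_integral_levels _ _ _ _ _ (Po mu) (Po nu) _ id id (monomial x) (cst c)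
  mid mid (unit_monomial mid x01) (unit_mfun_cst _ c01)) => l.
have -> : \int[Po mu]_k ((k == l)%:R * monomial x k) = monomial x l * fine (Po mu [set l]).
  rewrite -(integral_point (Po mu) (X := id))// -unit_integralZl; last exact: (unit_indicator _ l mid).
  by apply: eq_Rintegral => w _; case: eqP => [->|_]; rewrite ?mul1r ?mulr1// mul0r mulr0.
have -> : \int[Po nu]_k ((k == l)%:R * c) = c * fine (Po nu [set l]).
  rewrite -(integral_point (Po nu) (X := id))// -unit_integralZl; last exact: (unit_indicator _ l mid).
  by apply: eq_Rintegral => w _; rewrite mulrC.
rewrite !Po_point//= /c -sumrN expR_sum /monomial -!big_split/=; apply: eq_bigr => i _.
rewrite mxE exprMn.
have -> : expR (- mu 0 i) = expR (- (mu 0 i * (1 - x 0 i))) * expR (- (mu 0 i * x 0 i)).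
  by rewrite -expRD; congr expR; ring.
move: (expR (- (mu 0 i * (1 - x 0 i)))) (expR (- (mu 0 i * x 0 i))) => E1 E2.
by move: (_%:R^-1) (_ ^+ _) (_ ^+ _) => ? ? ?; ring.
Qed.

End poisson_law.

Section pgf_continuity.
Context d0 (T : measurableType d0) (R : realType) (P : probability T R).
Variables (d : nat) (X : nat -> {RV P >-> 'rV[nat]_d}) (mu : probability 'rV[nat]_d R).

(** Point masses converge, hence so do the integrals of functions supported by
    finitely many points; an exhaustion of the lattice by finite sets, in the order
    of an enumeration, supplies the tightness. *)
Lemma cvg_in_distribution_pgf :
  (forall x, in_cube x -> pgf P (X n) x @[n --> \oo] --> \int[mu]_k monomial x k) ->
  cvg_in_distribution X mu.
Proof.
move=> H f cf [M fM].
have u1 d1 (T1 : measurableType d1) : unit_mfun (cst 1 : T1 -> R).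
  by apply: unit_mfun_cst; rewrite ler01 lexx.
pose Ln n (g : 'rV[nat]_d -> R) := \int[P]_w (g (X n w) * 1).
pose L0 (g : 'rV[nat]_d -> R) := \int[mu]_k (g k * 1).
have mid : measurable_fun setT (@id 'rV[nat]_d) by [].
have hLn n : subunit_functional (Ln n) by exact: (subunit_expectation P _ (u1 _ T)).
have hL0 : subunit_functional L0 by exact: (subunit_expectation mu mid (u1 _ _)).
have LnE n g : Ln n g = \int[P]_w g (X n w).
  by apply: eq_Rintegral => w _; rewrite mulr1.
have L0E g : L0 g = \int[mu]_k g k by apply: eq_Rintegral => w _; rewrite mulr1.
have cpt : forall k, functional_cvg Ln L0 (fun z : 'rV[nat]_d => (z == k)%:R).
  apply: functional_cvg_point => // x x01; rewrite /functional_cvg L0E.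
  by under eq_fun do rewrite LnE; exact: H.
have P1 d1 (T1 : measurableType d1) (Q : probability T1 R) : \int[Q]_w (1 * 1) = 1.
  have PT : (1 : R) * fine (Q setT) = 1 by rewrite probability_setT mulr1.
  by rewrite mulr1 Rintegral_cst.
pose F (i : nat) (z : 'rV[nat]_d) : R := (choice.pickle z == i)%:R.
pose chi (m : nat) (z : 'rV[nat]_d) : R := (choice.pickle z < m)%:R.
have bF g i : bounded_real g -> bounded_real (fun z => g z * F i z).
  move=> [Mg hMg]; exists Mg => z; rewrite /F; case: eqP => _; rewrite ?mulr1//.
  by rewrite mulr0 normr0 (le_trans _ (hMg z)).
have b1 : bounded_real (fun _ : 'rV[nat]_d => 1 : R) by exists 1 => z; rewrite normr1.
have cF g i : bounded_real g -> functional_cvg Ln L0 (fun z => g z * F i z).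
  move=> bg; case E : (pickle_inv i : option 'rV[nat]_d) => [l|].
    rewrite (_ : (fun _ => _) = fun z => g l * (z == l)%:R + 0).
      apply: functional_cvg_lin => //; [|exact: bounded_real0|exact: functional_cvg0].
      by exists 1 => z; case: (z == l); rewrite ?normr1 ?normr0.
    apply/funext => z; rewrite addr0 /F.
    have il : i = choice.pickle l by have := @pickle_invK 'rV[nat]_d i; rewrite E.
    rewrite il (inj_eq (pcan_inj (@pickleK_inv 'rV[nat]_d))).
    by case: eqP => [->|_]; rewrite ?mulr0.
  rewrite (_ : (fun _ => _) = fun=> 0); first exact: functional_cvg0.
  apply/funext => z; rewrite /F; case: eqP => [zi|]; rewrite ?mulr0//.
  by move: E; rewrite -zi pickleK_inv.
have cchi g m : bounded_real g -> functional_cvg Ln L0 (fun z => g z * chi m z).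
  move=> bg.
  have [_] := functional_cvg_sum hLn hL0 (iota 0 m) (fun=> 1) (fun i => bF g i bg)
    (fun i => cF g i bg) (bounded_real0 _ _) (functional_cvg0 hLn hL0).
  rewrite (_ : (fun _ => _) = fun z => g z * chi m z)//.
  apply/funext => z; rewrite addr0; under eq_bigr do rewrite mul1r.
  rewrite -mulr_sumr; congr (_ * _); rewrite /chi /F.
  have [zm|zm] := ltnP (choice.pickle z) m.
    rewrite (bigD1_seq (choice.pickle z)) ?iota_uniq ?mem_iota//= eqxx big1 ?addr0// => i.
    by rewrite eq_sym => /negPf ->.
  rewrite big1_seq// => i /andP[_]; rewrite mem_iota/= add0n => im.
  by rewrite gtn_eqF// (leq_trans im).
have bfk : bounded_real (fun k => f (rV_natr R k)) by exists M.
have main : functional_cvg Ln L0 (fun k => f (rV_natr R k)).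
  apply: (functional_cvg_tight hLn hL0 _ _ (chi := chi)) => //.
  - by move=> n; exact: P1.
  - exact: P1.
  - by move=> m z; rewrite /chi; case: (_ < _)%N; rewrite ?lexx ler01.
  - move=> e e0.
    pose A m : set 'rV[nat]_d := [set z | (choice.pickle z < m)%N].
    have chiA m : L0 (chi m) = fine (mu (A m)).
      rewrite L0E; congr fine; rewrite -[X in _ = mu X]setIT -integral_indic//.
      apply: eq_integral => w _; rewrite indicE /chi.
      suff -> : (choice.pickle w < m)%N = (w \in A m) by [].
      by apply/idP/idP => [?|/set_mem//]; exact: mem_set.
    have UA : \bigcup_m A m = setT.
      apply/seteqP; split=> // z _; exists (choice.pickle z).+1 => //.
      exact: ltnSn.
    have cA : (mu \o A) m @[m --> \oo] --> 1%:E.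
      rewrite -(probability_setT mu) -UA; apply: nondecreasing_cvg_mu => //.
      by move=> m n mn; apply/subsetPset => z /= zm; exact: leq_trans zm mn.
    have [m _ hm] := (@cvgrPdist_le _ _ _ _ _ _ _).1 (fine_cvg cA) _ e0.
    by exists m; have := hm m (leqnn m); rewrite /= chiA ler_norml => /andP[_ ?]; lra.
  - move=> m; rewrite (_ : chi m = fun z => 1 * chi m z); first exact: cchi.
    by apply/funext => z; rewrite mul1r.
  - by move=> m; exact: cchi.
have EF d1 (T1 : measurableType d1) (Q : probability T1 R) (Z : T1 -> 'rV[nat]_d) :
    measurable_fun setT Z ->
    (\int[Q]_w (f (rV_natr R (Z w)))%:E)%E = (\int[Q]_w f (rV_natr R (Z w)))%:E.
  move=> mZ; rewrite fineK//; apply: integrable_fin_num => //.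
  apply: (@bounded_integrable _ _ _ _ _ M) => //.
  apply: (measurableT_comp (f := fun k => f (rV_natr R k))) => //.
rewrite (EF _ _ mu id)// -L0E (_ : (fun n => _) = fun n => (Ln n (fun k => f (rV_natr R k)))%:E).
  by apply: cvg_EFin; [exact: nearW|exact: main].
by apply/funext => n; rewrite unlock LnE EF.
Qed.

End pgf_continuity.

(** * Left derivatives of generating functions *)

Section difference_quotients.
Variable R : realType.

(** The difference quotient of [z |-> z ^ n] at [y], in a form without division, so
    that it also makes sense at [h = 0], where it is the derivative. *)
Definition power_quotient (y : R) (n : nat) (h : R) : R :=
  \sum_(i < n) (y + h) ^+ (n.-1 - i) * y ^+ i.

Lemma power_quotientE y n h : (y + h) ^+ n - y ^+ n = h * power_quotient y n h.
Proof. by rewrite subrXX addrAC subrr add0r. Qed.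

Lemma power_quotient0 y n : power_quotient y n 0 = n%:R * y ^+ n.-1.
Proof.
rewrite /power_quotient (eq_bigr (fun=> y ^+ n.-1)) ?sumr_const ?card_ord ?mulr_natl// => i _.
by rewrite addr0 -exprD subnK// -ltnS prednK// (leq_ltn_trans _ (ltn_ord i)).
Qed.

Lemma power_quotient_ge0 y n h : 0 <= y -> 0 <= y + h -> 0 <= power_quotient y n h.
Proof. by move=> y0 yh0; apply: sumr_ge0 => i _; rewrite mulr_ge0// exprn_ge0. Qed.

Lemma power_quotient_le y n h h' : 0 <= y -> 0 <= y + h -> h <= h' -> power_quotient y n h <= power_quotient y n h'.
Proof.
move=> y0 yh0 hh'; apply: ler_sum => i _; rewrite ler_wpM2r ?exprn_ge0//.
by rewrite lerXn2r ?nnegrE ?(le_trans yh0)// lerD2l.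
Qed.

Lemma power_quotient_cvg y n : power_quotient y n h @[h --> 0] --> power_quotient y n 0.
Proof.
apply: cvg_big => [|i _]; first exact: add_continuous.
apply: cvgM; last exact: cvg_cst.
apply: (cvg_comp (fun h => y + h) (fun z => z ^+ (n.-1 - i))); last exact: exprn_continuous.
by apply: cvgD; [exact: cvg_cst|exact: cvg_id].
Qed.

End difference_quotients.

Section monotone_limit.
Context d0 (T : measurableType d0) (R : realType) (P : probability T R).
Variables (d : nat) (Z : T -> 'rV[nat]_d).
Hypothesis mZ : measurable_fun setT Z.

Lemma measurable_EFin_lattice (g : 'rV[nat]_d -> R) :
  measurable_fun setT (fun w => (g (Z w))%:E).
Proof. by apply: measurableT_comp => //; exact: measurableT_comp. Qed.

(** Monotone convergence along the filter of left neighbourhoods. The limit may be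
    infinite: the function of [h] is monotone, so its left limit is a supremum, and
    a sequence increasing to 0 identifies it. *)
Lemma integral_cvg_at_left (Q : R -> 'rV[nat]_d -> R) (b : R) : 0 < b ->
  (forall h k, - b < h <= 0 -> 0 <= Q h k) ->
  (forall h h' k, - b < h -> h <= h' -> h' <= 0 -> Q h k <= Q h' k) ->
  (forall k, Q h k @[h --> 0] --> Q 0 k) ->
  (\int[P]_w (Q h (Z w))%:E @[h --> 0^'-] --> \int[P]_w (Q 0 (Z w))%:E)%E.
Proof.
move=> b0 Q0 Qle Qcvg.
pose F h := (\int[P]_w (Q h (Z w))%:E)%E.
have Fle h h' : - b < h -> h <= h' -> h' <= 0 -> (F h <= F h')%E.
  move=> bh hh' h'0; apply: ge0_le_integral => //.
  - by move=> w _; rewrite lee_fin Q0// bh (le_trans hh').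
  - exact: measurable_EFin_lattice.
  - exact: measurable_EFin_lattice.
  - by move=> w _; rewrite lee_fin Qle.
pose s n : R := - (b / n.+2%:R).
have s0 n : s n < 0 by rewrite oppr_lt0 divr_gt0.
have sb n : - b < s n by rewrite ltrN2 ltr_pdivrMr// ltr_pMr// ltr1n.
have sle n m : (n <= m)%N -> s n <= s m.
  by move=> nm; rewrite lerN2 ler_pM2l// lef_pV2 ?posrE// ler_nat.
have scvg : s n @[n --> \oo] --> 0.
  rewrite -oppr0; apply: cvgN; rewrite -(mulr0 b); apply: cvgM; first exact: cvg_cst.
  have := @cvg_harmonic R; rewrite -(cvg_shiftS (@harmonic R)); exact: cvg_trans.
have Fs : F (s n) @[n --> \oo] --> F 0.
  have := @cvg_monotone_convergence _ _ _ P setT measurableT (fun n w => (Q (s n) (Z w))%:E) _ _ _.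
  have -> : (\int[P]_w (limn (fun n => (Q (s n) (Z w))%:E)) = F 0%R)%E.
    apply: eq_integral => w _; apply: cvg_lim => //.
    apply: cvg_EFin; first exact: nearW.
    by apply: (cvg_comp s (fun h => Q h (Z w))); [exact: scvg|exact: Qcvg].
  apply.
  - by move=> n; exact: measurable_EFin_lattice.
  - by move=> n w _; rewrite lee_fin Q0// sb ltW.
  - by move=> w _ n m nm; rewrite lee_fin Qle ?sle// ltW.
apply/cvg_at_leftNP; rewrite oppr0.
have H := @nonincreasing_at_right_cvge R (F \o -%R) 0 (BLeft b) _ _.
have /H{H} : (BRight 0 < BLeft b)%O by rewrite bnd_simp.
have Fmono : {in Interval (BRight 0) (BLeft b) &,
    {homo F \o -%R : n m / n <= m >-> (m <= n)%E}}.
  move=> x y; rewrite !in_itv/= => /andP[x0 xb] /andP[y0 yb] xy.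
  by apply: Fle; rewrite ?ltrN2 ?lerN2// oppr_le0 ltW.
move=> /(_ Fmono); suff -> : ereal_sup [set (F \o -%R) x | x in [set` `]0, b[]] = F 0 by [].
apply/eqP; rewrite eq_le; apply/andP; split.
  apply: ge_ereal_sup => _ [x /= + <-]; rewrite in_itv/= => /andP[x0 xb].
  by apply: Fle => //; rewrite ?ltrN2// oppr_le0 ltW.
rewrite -(cvg_lim _ Fs)//; apply: lime_le; first by apply/cvg_ex; exists (F 0).
apply: nearW => n; apply: ereal_sup_ubound; exists (- s n); last by rewrite /= opprK.
by rewrite /= in_itv/= oppr_gt0 s0/= ltrNl sb.
Qed.

End monotone_limit.

(** The number of ordered pairs of distinct individuals, one of type [l] and one of
    type [j]; its mean is the second factorial moment. *)
Definition pair_count d (j l : 'I_d) (k : 'rV[nat]_d) : nat :=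
  (k ord0 l * (k ord0 j - (j == l)))%N.

Section pgf_derivatives.
Context d0 (T : measurableType d0) (R : realType) (P : probability T R).
Variables (d : nat) (Z : T -> 'rV[nat]_d).
Hypothesis mZ : measurable_fun setT Z.
Hypothesis Zfin : forall l, (\int[P]_w ((Z w 0 l)%:R)%:E < +oo)%E.

Lemma dominated_integrable (g : 'rV[nat]_d -> R) l : (forall k, `|g k| <= (k 0 l)%:R) ->
  P.-integrable setT (EFin \o (fun w => g (Z w))).
Proof.
move=> gl; apply: (@le_integrable _ _ _ _ _ measurableT _ (EFin \o (fun w => (Z w 0 l)%:R))).
- exact: (measurable_EFin_lattice mZ g).
- by move=> w _ /=; rewrite lee_fin (le_trans (gl _))// ler_norm.
apply/integrableP; split; first exact: (measurable_EFin_lattice mZ (fun k => (k 0 l)%:R)).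
by under eq_integral do rewrite /= ger0_norm//.
Qed.

Lemma dominated_EFin (g : 'rV[nat]_d -> R) l : (forall k, `|g k| <= (k 0 l)%:R) ->
  (\int[P]_w (g (Z w))%:E)%E = (\int[P]_w g (Z w))%:E.
Proof.
by move=> gl; rewrite fineK//; apply: integrable_fin_num => //; exact: dominated_integrable gl.
Qed.

Definition partial_monomial (l : 'I_d) (y : 'rV[R]_d) (k : 'rV[nat]_d) : R :=
  \prod_(i < d | i != l) y 0 i ^+ k 0 i * power_quotient (y 0 l) (k 0 l) 0.

Lemma monomial_shift l (y : 'rV[R]_d) h k :
  monomial (y + h *: delta_mx ord0 l) k - monomial y k =
  h * (\prod_(i < d | i != l) y 0 i ^+ k 0 i * power_quotient (y 0 l) (k 0 l) h).
Proof.
rewrite /monomial (bigD1 l)//= [in X in _ - X](bigD1 l)//= !mxE !eqxx/= mulr1.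
rewrite (eq_bigr (fun i => y 0 i ^+ k 0 i)) => [|i il]; last first.
  by rewrite !mxE (negPf il) andbF mulr0 addr0.
by rewrite -mulrBl power_quotientE; ring.
Qed.

(** Difference quotients of monomials increase as [h] increases to 0, so the
    derivative passes under the integral; it is finite since the mean is. *)
Lemma left_partial_pgf l (y : 'rV[R]_d) : in_cube y -> 0 < y 0 l ->
  left_partial l (pgf P Z) y = (\int[P]_w partial_monomial l y (Z w))%:E.
Proof.
move=> y01 yl; have yl0 := ltW yl; have /andP[_ yl1] := y01 l.
set c := fun k : 'rV[nat]_d => \prod_(i < d | i != l) y 0 i ^+ k 0 i.
have c01 k : 0 <= c k <= 1.
  rewrite /c prodr_ge0 ?prodr_ile1// => i _; have /andP[? ?] := y01 i.
    by rewrite exprn_ge0// exprn_ile1.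
  by rewrite exprn_ge0.
have quotient_dom h n : - y 0 l < h -> h <= 0 -> `|power_quotient (y 0 l) n h| <= n%:R.
  move=> yh h0; have yh0 : 0 <= y 0 l + h by rewrite -lerBlDl sub0r ltW.
  rewrite ger0_norm ?power_quotient_ge0// (le_trans (power_quotient_le _ yl0 yh0 h0))//.
  by rewrite power_quotient0 ler_piMr// exprn_ile1.
have dom h k : - y 0 l < h -> h <= 0 -> `|c k * power_quotient (y 0 l) (k 0 l) h| <= (k 0 l)%:R.
  move=> yh h0; have /andP[? ?] := c01 k.
  rewrite normrM (le_trans (ler_piMl _ _)) ?quotient_dom//.
  by rewrite ger0_norm.
have H := @integral_cvg_at_left _ _ _ P _ Z mZ
  (fun h k => c k * power_quotient (y 0 l) (k 0 l) h) (y 0 l) yl _ _ _.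
rewrite /left_partial; apply: cvg_lim => //.
rewrite -(dominated_EFin (g := partial_monomial l y) (l := l)); last first.
  by move=> k; apply: dom; rewrite ?oppr_lt0.
apply: cvg_trans (H _ _ _); first last.
- by move=> k; apply: cvgM; [exact: cvg_cst|exact: power_quotient_cvg].
- move=> h h' k ? ? ?; have /andP[? ?] := c01 k.
  by rewrite ler_wpM2l// power_quotient_le// -lerBlDl sub0r ltW.
- by move=> h k /andP[? ?]; have /andP[? ?] := c01 k; rewrite mulr_ge0// power_quotient_ge0// -lerBlDl sub0r ltW.
apply: near_eq_cvg; near=> h.
have h0 : h < 0 by near: h; exact: nbhs_left_lt.
have yh : - y 0 l < h by near: h; apply: nbhs_left_gt; rewrite oppr_lt0.
have yhc : in_cube (y + h *: delta_mx ord0 l).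
  move=> i; rewrite !mxE eqxx/=; have /andP[? ?] := y01 i.
  by case: (i =P l) => [->|_]; rewrite /= ?mulr1 ?mulr0 ?addr0; apply/andP; split; lra.
rewrite (dominated_EFin (g := fun k => c k * power_quotient (y 0 l) (k 0 l) h) (l := l)) => [|k]; last by rewrite dom// ltW.
congr EFin; rewrite /pgf -RintegralB//; try exact/unit_integrable/unit_monomial.
under [in RHS]eq_Rintegral do rewrite monomial_shift.
rewrite RintegralZl//; last first.
  by apply: (dominated_integrable (g := fun k => c k * power_quotient (y 0 l) (k 0 l) h) (l := l)) => k; rewrite dom// ltW.
by rewrite mulKf// lt_eqF.
Unshelve. all: by end_near. Qed.

(** The same argument once more, except that the second factorial moment may be
    infinite. *)
Lemma left_partial2_pgf j l :
  left_partial2 j l (pgf P Z) (const_mx 1) =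
  (\int[P]_w ((pair_count j l (Z w))%:R)%:E)%E.
Proof.
pose K (k : 'rV[nat]_d) := (k ord0 j - (j == l))%N.
have cube h : - 1 < h -> h <= 0 ->
    in_cube (const_mx 1 + h *: delta_mx ord0 j : 'rV[R]_d).
  move=> h1 h0 i; rewrite !mxE eqxx/=.
  by case: (i == j); rewrite /= ?mulr1 ?mulr0 ?addr0; apply/andP; split; lra.
have partialE h : - 1 < h -> h <= 0 ->
    fine (left_partial l (pgf P Z) (const_mx 1 + h *: delta_mx ord0 j)) =
    \int[P]_w ((Z w 0 l)%:R * (1 + h) ^+ K (Z w)).
  move=> h1 h0; rewrite left_partial_pgf; last 2 first.
  - exact: cube.
  - by rewrite !mxE eqxx/=; case: (l == j); rewrite /= ?mulr1 ?mulr0 ?addr0; lra.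
  apply: eq_Rintegral => w _; rewrite /partial_monomial power_quotient0 mulrCA; congr (_ * _).
  have E i : (const_mx 1 + h *: delta_mx ord0 j : 'rV[R]_d) 0 i = if i == j then 1 + h else 1.
    by rewrite !mxE eqxx/=; case: (i == j); rewrite ?mulr1 ?mulr0 ?addr0.
  under eq_bigr do rewrite E.
  rewrite E /K; have [->|jl] := eqVneq j l.
    rewrite subn1 big1 ?mul1r// => i /negPf ->; exact: expr1n.
  rewrite subn0 expr1n mulr1 (bigD1 j)//= eqxx big1 ?mulr1// => i.
  by move=> /andP[_ /negPf ->]; exact: expr1n.
have dom (h : R) (k : 'rV[nat]_d) : - 1 < h -> h <= 0 -> `|(k 0 l)%:R * (1 + h) ^+ K k| <= (k 0 l)%:R.
  by move=> h1 h0; rewrite ger0_norm ?mulr_ge0 ?exprn_ge0 ?ler_piMr ?exprn_ile1//; lra.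
have H := @integral_cvg_at_left _ _ _ P _ Z mZ
  (fun h k => (k 0 l)%:R * power_quotient 1 (K k) h) 1 ltr01 _ _ _.
rewrite /left_partial2 {1}/left_partial; apply: cvg_lim => //.
have -> : (\int[P]_w ((pair_count j l (Z w))%:R)%:E =
    \int[P]_w ((Z w 0 l)%:R * power_quotient 1 (K (Z w)) 0)%:E)%E.
  by apply: eq_integral => w _; rewrite power_quotient0 expr1n mulr1 -natrM.
apply: cvg_trans (H _ _ _); first last.
- by move=> k; apply: cvgM; [exact: cvg_cst|exact: power_quotient_cvg].
- by move=> h h' k ? ? ?; rewrite ler_wpM2l// power_quotient_le//; lra.
- by move=> h k /andP[? ?]; rewrite mulr_ge0// power_quotient_ge0//; lra.
apply: near_eq_cvg; near=> h.
have h0 : h < 0 by near: h; exact: nbhs_left_lt.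
have h1 : - 1 < h by near: h; apply: nbhs_left_gt; rewrite oppr_lt0.
have E1 := partialE 0 (ltrN10 R) (lexx 0).
rewrite scale0r addr0 in E1.
pose u w : R := (Z w 0 l)%:R * (1 + h) ^+ K (Z w).
pose v w : R := (Z w 0 l)%:R * (1 + 0) ^+ K (Z w).
transitivity (EFin (h^-1 * (\int[P]_w u w - \int[P]_w v w))); last first.
  by congr (EFin (_ * (_ - _))); [rewrite -(partialE h h1 (ltW h0))|rewrite -E1].
have iu : P.-integrable setT (EFin \o u).
  by apply: (dominated_integrable (g := fun k => (k 0 l)%:R * (1 + h) ^+ K k) (l := l)) => k; rewrite dom// ltW.
have iv : P.-integrable setT (EFin \o v).
  by apply: (dominated_integrable (g := fun k => (k 0 l)%:R * (1 + 0) ^+ K k) (l := l)) => k; rewrite dom// ltrN10.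
rewrite -RintegralB//.
have E (k : 'rV[nat]_d) : (k 0 l)%:R * (1 + h) ^+ K k - (k 0 l)%:R * (1 + 0) ^+ K k =
    h * ((k 0 l)%:R * power_quotient 1 (K k) h).
  by rewrite addr0 -mulrBr power_quotientE mulrCA.
have iuv : P.-integrable setT (EFin \o (fun w => u w - v w)).
  by have := integrableB measurableT iu iv; apply: eq_integrable.
have ig : P.-integrable setT (EFin \o (fun w => h^-1 * (u w - v w))).
  by have := integrableZl measurableT h^-1 iuv; apply: eq_integrable.
transitivity (\int[P]_w (h^-1 * (u w - v w))%:E)%E.
  by apply: eq_integral => w _; rewrite /u /v E mulKf// lt_eqF.
by rewrite -RintegralZl// fineK//; exact: (integrable_fin_num measurableT ig).
Unshelve. all: by end_near. Qed.

End pgf_derivatives.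

(** * Second-order expansion of a generating function at 1 *)

Section second_order_expansion.
Variable R : realType.

(** The inclusion-exclusion bounds of orders 1 and 2 for a product [p] of factors
    [1 - a], where [s] is the sum of the [a] and [t] the sum of their squares. In
    this form the property is multiplicative. *)
Definition bonferroni (p s t : R) :=
  [/\ 0 <= p <= 1, 1 - s <= p & p <= 1 - s + (s ^+ 2 - t) / 2].

Lemma bonferroni1 : bonferroni 1 0 0.
Proof. by split; lra. Qed.

Lemma bonferroniM p s t p' s' t' : bonferroni p s t -> bonferroni p' s' t' ->
  bonferroni (p * p') (s + s') (t + t').
Proof.
move=> [/andP[p0 p1] h1 h2] [/andP[p0' p1'] h1' h2'].
(* p p' = p + p' - 1 + (1 - p) (1 - p'). *)
have k1 : 0 <= (1 - p) * (1 - p') by rewrite mulr_ge0//; lra.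
have k2 : (1 - p) * (1 - p') <= s * s' by apply: ler_pM; lra.
by split; [rewrite mulr_ge0//= mulr_ile1| |]; lra.
Qed.

Lemma bonferroniX u k : 0 <= u <= 1 ->
  bonferroni ((1 - u) ^+ k) (k%:R * u) (k%:R * u ^+ 2).
Proof.
move=> /andP[u0 u1]; elim: k => [|k IH]; first by rewrite !mul0r; exact: bonferroni1.
have E (a : R) : k.+1%:R * a = a + k%:R * a by rewrite -natr1 mulrDl mul1r addrC.
rewrite exprS !E; apply: bonferroniM => //.
by split; [apply/andP; split| |]; lra.
Qed.

Lemma bonferroni_monomial d (x : 'rV[R]_d) k : in_cube x ->
  bonferroni (monomial x k) (\sum_(i < d) (k 0 i)%:R * (1 - x 0 i))
    (\sum_(i < d) (k 0 i)%:R * (1 - x 0 i) ^+ 2).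
Proof.
move=> x01; rewrite /monomial; elim/big_ind3: _ => [||i _].
- exact: bonferroni1.
- by move=> *; exact: bonferroniM.
have /andP[? ?] := x01 i.
rewrite -{1}(subKr 1 (x 0 i)); apply: bonferroniX; apply/andP; split; lra.
Qed.

Lemma sum_pair_count d (k : 'rV[nat]_d) (u : 'I_d -> R) :
  (\sum_(i < d) (k 0 i)%:R * u i) ^+ 2 - \sum_(i < d) (k 0 i)%:R * u i ^+ 2 =
  \sum_(j < d) \sum_(l < d) (pair_count j l k)%:R * (u j * u l).
Proof.
have E j l : (pair_count j l k)%:R = (k 0 j)%:R * (k 0 l)%:R - (j == l)%:R * (k 0 l)%:R :> R.
  rewrite /pair_count natrM; case: eqP => [->|_]; last by rewrite subn0 mul0r subr0 mulrC.
  case: (k ord0 l) => [|n]; first by rewrite !mul0r mulr0 subr0.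
  by rewrite subn1/= -natr1; ring.
rewrite expr2 big_distrlr/= -sumrB; apply: eq_bigr => j _.
under [in RHS]eq_bigr do rewrite E mulrBl.
rewrite sumrB; congr (_ - _); first by apply: eq_bigr => l _; ring.
rewrite (bigD1 j)//= eqxx mul1r big1 ?addr0 ?expr2// => l.
by rewrite eq_sym => /negPf ->; rewrite !mul0r.
Qed.

End second_order_expansion.

Section pgf_expansion.
Context d0 (T : measurableType d0) (R : realType) (P : probability T R).
Variables (d : nat) (Z : T -> 'rV[nat]_d).
Hypothesis mZ : measurable_fun setT Z.
Hypothesis Zfin : forall l, (\int[P]_w ((Z w 0 l)%:R)%:E < +oo)%E.

(** What the linear approximation of [1 - pgf P Z x] overestimates. *)
Definition pgf_remainder (x : 'rV[R]_d) : R :=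
  \sum_(l < d) (\int[P]_w (Z w 0 l)%:R) * (1 - x 0 l) - (1 - pgf P Z x).

Let S (x : 'rV[R]_d) (w : T) : R := \sum_(l < d) (Z w 0 l)%:R * (1 - x 0 l).

Let S_ge0 x w : in_cube x -> 0 <= S x w.
Proof.
by move=> x01; apply: sumr_ge0 => l _; have /andP[? ?] := x01 l; rewrite mulr_ge0// subr_ge0.
Qed.

Let mS x : measurable_fun setT (fun w => (S x w)%:E).
Proof. exact: (measurable_EFin_lattice mZ (fun k => \sum_(l < d) (k 0 l)%:R * (1 - x 0 l))). Qed.

Let intS x : in_cube x ->
  (\int[P]_w (S x w)%:E = (\sum_(l < d) (\int[P]_w (Z w 0 l)%:R) * (1 - x 0 l))%:E)%E.
Proof.
move=> x01; have x1 l : 0 <= 1 - x 0 l by have /andP[? ?] := x01 l; rewrite subr_ge0.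
rewrite -sumEFin; under eq_integral do rewrite /S -sumEFin.
rewrite ge0_integral_sum//; first last.
- by move=> l w _; rewrite lee_fin mulr_ge0.
- by move=> l; exact: (measurable_EFin_lattice mZ (fun k => (k 0 l)%:R * (1 - x 0 l))).
apply: eq_bigr => l _; rewrite EFinM -(dominated_EFin mZ Zfin (g := fun k => (k 0 l)%:R) (l := l)); last first.
  by move=> k; rewrite ger0_norm.
under eq_integral do rewrite EFinM muleC.
rewrite ge0_integralZl_EFin//; first by rewrite muleC.
exact: (measurable_EFin_lattice mZ (fun k => (k 0 l)%:R)).
Qed.

Lemma pgf_remainderE x : in_cube x ->
  (\int[P]_w (S x w - (1 - monomial x (Z w)))%:E = (pgf_remainder x)%:E)%E.
Proof.
move=> x01.
have iS : P.-integrable setT (EFin \o S x).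
  apply/integrableP; split; first exact: mS.
  by under eq_integral do rewrite /= ger0_norm ?S_ge0//; rewrite intS// ltry.
have im : P.-integrable setT (EFin \o (fun w => monomial x (Z w))).
  by apply: unit_integrable; exact: unit_monomial.
have i1 : P.-integrable setT (EFin \o (cst 1 : T -> R)) by exact: finite_measure_integrable_cst.
have i1m : P.-integrable setT (EFin \o (fun w => 1 - monomial x (Z w))).
  by have := integrableB measurableT i1 im; apply: eq_integrable.
have iSm : P.-integrable setT (EFin \o (fun w => S x w - (1 - monomial x (Z w)))).
  by have := integrableB measurableT iS i1m; apply: eq_integrable.
rewrite -[LHS]fineK; last exact: (integrable_fin_num measurableT iSm).
congr EFin; rewrite -[fine _]/(\int[P]_w (S x w - (1 - monomial x (Z w)))).
rewrite RintegralB// RintegralB// /pgf_remainder; congr (_ - (_ - _)).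
  by rewrite /Rintegral intS.
have PT : (1 : R) * fine (P setT) = 1 by rewrite probability_setT mulr1.
by rewrite Rintegral_cst.
Qed.

Lemma pgf_remainder_ge0 x : in_cube x -> 0 <= pgf_remainder x.
Proof.
move=> x01; rewrite -lee_fin -pgf_remainderE//; apply: integral_ge0 => w _.
by rewrite lee_fin; have [_ + _] := bonferroni_monomial (Z w) x01; rewrite /S; lra.
Qed.

Lemma pgf_remainder_le x (M c : R) : in_cube x -> (forall i, 1 - x 0 i <= c) ->
  (forall j l, (\int[P]_w ((pair_count j l (Z w))%:R)%:E <= M%:E)%E) ->
  pgf_remainder x <= d%:R ^+ 2 * M * c ^+ 2.
Proof.
move=> x01 xc pM.
have x1 l : 0 <= 1 - x 0 l by have /andP[? ?] := x01 l; rewrite subr_ge0.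
rewrite -lee_fin -pgf_remainderE//.
apply: (@le_trans _ _ (\int[P]_w (\sum_(j < d) \sum_(l < d)
    ((c ^+ 2)%:E * ((pair_count j l (Z w))%:R)%:E)))%E).
  apply: ge0_le_integral => //.
  - move=> w _; rewrite lee_fin; have [_ + _] := bonferroni_monomial (Z w) x01.
    by rewrite /S; lra.
  - exact: (measurable_EFin_lattice mZ (fun k => \sum_(l < d) (k 0 l)%:R * (1 - x 0 l) - (1 - monomial x k))).
  - by apply: measurableT_comp (measurable_lattice (fun k => \sum_(j < d) \sum_(l < d)
      ((c ^+ 2)%:E * ((pair_count j l k)%:R)%:E))%E) mZ.
  move=> w _.
  have -> : (\sum_(j < d) \sum_(l < d) ((c ^+ 2)%:E * ((pair_count j l (Z w))%:R)%:E) =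
      (\sum_(j < d) \sum_(l < d) (c ^+ 2 * (pair_count j l (Z w))%:R))%:E)%E.
    by rewrite -sumEFin; apply: eq_bigr => j _; rewrite -sumEFin.
  rewrite lee_fin.
  have h0 : 0 <= \sum_(j < d) \sum_(l < d) (pair_count j l (Z w))%:R * ((1 - x 0 j) * (1 - x 0 l)).
    by apply: sumr_ge0 => j _; apply: sumr_ge0 => l _; rewrite !mulr_ge0.
  have h : \sum_(j < d) \sum_(l < d) (pair_count j l (Z w))%:R * ((1 - x 0 j) * (1 - x 0 l)) <=
      \sum_(j < d) \sum_(l < d) (c ^+ 2 * (pair_count j l (Z w))%:R).
    apply: ler_sum => j _; apply: ler_sum => l _.
    by rewrite mulrC expr2 ler_wpM2r// ler_pM.
  have [_ _] := bonferroni_monomial (Z w) x01.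
  by rewrite sum_pair_count /S; move: h0 h; lra.
rewrite ge0_integral_sum//; first last.
- by move=> j w _; apply: sume_ge0 => l _; rewrite -EFinM lee_fin mulr_ge0 ?sqr_ge0.
- by move=> j; apply: measurableT_comp (measurable_lattice (fun k => \sum_(l < d)
      ((c ^+ 2)%:E * ((pair_count j l k)%:R)%:E))%E) mZ.
have -> : (d%:R ^+ 2 * M * c ^+ 2)%:E = (\sum_(j < d) \sum_(l < d) ((c ^+ 2)%:E * M%:E))%E.
  transitivity (\sum_(j < d) \sum_(l < d) (c ^+ 2 * M))%:E.
    congr EFin; rewrite !sumr_const !card_ord -mulr_natl -[_ *+ d]mulr_natl; ring.
  by rewrite -sumEFin; apply: eq_bigr => j _; rewrite -sumEFin.
apply: lee_sum => j _.
rewrite ge0_integral_sum//; first last.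
- by move=> l w _; rewrite -EFinM lee_fin mulr_ge0 ?sqr_ge0.
- by move=> l; apply: measurableT_comp (measurable_lattice (fun k =>
      ((c ^+ 2)%:E * ((pair_count j l k)%:R)%:E))%E) mZ.
apply: lee_sum => l _.
rewrite ge0_integralZl_EFin ?sqr_ge0//.
- by rewrite lee_wpmul2l ?lee_fin ?sqr_ge0.
- exact: (measurable_EFin_lattice mZ (fun k => (pair_count j l k)%:R)).
Qed.

End pgf_expansion.

(** * Poisson limit of the process *)

Section backward_iteration.
Variables (U : Type) (G : nat -> U -> U).

(** The composition [G_(j+1) o ... o G_n]; it is built by recursion on [n] because
    the generating function of generation [n] is obtained from the one of generation
    [n - 1] by applying [G_n] first. *)
Fixpoint backward (j n : nat) (x : U) : U :=
  if n is n'.+1 then if (j <= n')%N then backward j n' (G n x) else x else x.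

Lemma backward_id n x : backward n n x = x.
Proof. by case: n => //= n; rewrite ltnn. Qed.

Lemma backward_step j n x : (j < n)%N -> backward j n x = G j.+1 (backward j.+1 n x).
Proof.
elim: n x => // n IH x; rewrite ltnS /= => jn; rewrite jn.
move: jn; rewrite leq_eqVlt => /predU1P[->|jn]; first by rewrite ltnn backward_id.
by rewrite jn IH.
Qed.

End backward_iteration.

Section gwi_product.
Context d0 (T : measurableType d0) (R : realType) (P : probability T R).
Variables (d : nat) (xi : nat -> nat -> 'I_d -> {RV P >-> 'rV[nat]_d}).
Variables (eps X : nat -> {RV P >-> 'rV[nat]_d}).
Hypothesis hX : is_gwi xi eps X.

Lemma backward_cube j n x : in_cube x -> in_cube (backward (offspring_point xi) j n x).
Proof.
elim: n x => //= n IH x x01; case: ifP => // _.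
by apply: IH; exact: offspring_point_cube.
Qed.

Lemma gwi_pgf_prod n x : in_cube x ->
  pgf P (X n) x =
  \prod_(1 <= j < n.+1) pgf P (eps j) (backward (offspring_point xi) j n x).
Proof.
elim: n x => [|n IH] x x01.
  rewrite big_geq// /pgf; under eq_Rintegral do rewrite (gwi_init hX) monomial0.
  have PT : (1 : R) * fine (P setT) = 1 by rewrite probability_setT mulr1.
  by rewrite Rintegral_cst.
rewrite (gwi_pgf_rec hX)// big_nat_recr//= ltnn; congr (_ * _).
rewrite IH; last exact: offspring_point_cube.
by rewrite !big_nat; apply: eq_bigr => j /andP[_ jn]; rewrite -ltnS jn.
Qed.

End gwi_product.

Section second_moments.
Context d0 (T : measurableType d0) (R : realType) (P : probability T R).
Variables (d : nat) (xi : nat -> nat -> 'I_d -> {RV P >-> 'rV[nat]_d}).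
Variables (eps X : nat -> {RV P >-> 'rV[nat]_d}).
Hypothesis hX : is_gwi xi eps X.

Lemma offspring_fin n i l : (0 < n)%N -> (\int[P]_w ((xi n 1 i w 0 l)%:R)%:E < +oo)%E.
Proof. by move=> n0; have := gwi_offspring_fin hX i l n0; rewrite unlock. Qed.

Lemma offspring_pgfE n i : offspring_pgf xi n i = pgf P (xi n 1%N i).
Proof. by apply/funext => x; rewrite /offspring_pgf expectationE. Qed.

Lemma le_m2 n i j l : (0 < n)%N ->
  (\int[P]_w ((pair_count j l (xi n 1%N i w))%:R)%:E <= m2 xi n)%E.
Proof.
move=> n0; rewrite -left_partial2_pgf// => [|k]; last exact: offspring_fin.
rewrite -offspring_pgfE /m2; apply: le_trans (le_bigmax _ _ i).
by apply: le_trans (le_bigmax _ _ j); exact: le_bigmax.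
Qed.

Lemma m2_ge0 n : (0 < d)%N -> (0 < n)%N -> (0 <= m2 xi n)%E.
Proof.
move=> d_gt0 n0; apply: le_trans (le_m2 (Ordinal d_gt0) (Ordinal d_gt0) (Ordinal d_gt0) n0).
by apply: integral_ge0 => w _; rewrite lee_fin.
Qed.

End second_moments.

Theorem theorem3 (R : realType) (d : nat) (hd : (0 < d)%N)
    (disp : measure_display) (T : measurableType disp) (P : probability T R)
    (xi : nat -> nat -> 'I_d -> {RV P >-> 'rV[nat]_d})
    (eps X : nat -> {RV P >-> 'rV[nat]_d})
    (hX : is_gwi xi eps X)
    (B : nat -> 'M[R]_d) (m : nat -> 'rV[R]_d)
    (hB : forall n, (0 < n)%N -> B n = offspring_mean xi n)
    (hm : forall n, (0 < n)%N -> m n = immigration_mean eps n)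
    (hBe : forall n A, (0 < n)%N -> distribution P (eps n) A = Be (m n) A)
    (N : 'rV[R]_d -> R) (hN : is_norm N)
    (A : 'M[R]_d) (lambda : 'rV[R]_d)
    (B1 : B @ \oo --> (1%:M : 'M[R]_d))
    (B2 : exists n0 : nat, forall n, (n0 <= n)%N ->
       opnorm N (B n) <= 1 /\ 1%:M - B n \in unitmx)
    (B3 : forall j : nat, opnorm N (mxprod B j n) @[n --> \oo] --> (0 : R))
    (B4 : (\sum_(1 <= j < n.+1) (1%:M - B j) *m mxprod B j n) @[n --> \oo]
       --> A)
    (B5 : has_ubound (range (fun n : nat =>
       \sum_(1 <= j < n.+1) opnorm N ((1%:M - B j) *m mxprod B j n))))
    (hM : m n *m invmx (1%:M - B n) @[n --> \oo] --> lambda)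
    (hm2 : (m2 xi n * (opnorm N (invmx (1%:M - B n)))%:E)%E @[n --> \oo]
       --> (0 : \bar R)%E) :
  cvg_in_distribution X (Po lambda).
Proof.
have [n0 hn0] := B2; have [C0 hC0] := B5.
have [c c_ge0 hc] := mx_norm_le_lipschitz hN hd.
have norm_le (M : 'M[R]_d) : `|M| <= c * opnorm N M by apply: hc; exact: le_opnorm.
have [K K0 hK] := mxprod_bounded hN hd (fun n n0n => (hn0 n n0n).1).
have [/= [n1 _ fin1] cvg1] := (fine_cvgP _ _).1 hm2.
pose N0 := maxn 1 (maxn n0 n1).
have N1 n : (N0 <= n)%N -> (0 < n)%N by rewrite /N0 geq_max => /andP[].
have Nn0 n : (N0 <= n)%N -> (n0 <= n)%N by rewrite /N0 !geq_max => /and3P[].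
have Nn1 n : (N0 <= n)%N -> (n1 <= n)%N by rewrite /N0 !geq_max => /and3P[].
have unit_n n : (N0 <= n)%N -> 1%:M - B n \in unitmx by move=> /Nn0/hn0[].
(* An invertible matrix of positive size has a positive operator norm, so that a
   finite product with m2 forces m2 to be finite. *)
have inv_gt0 n : (N0 <= n)%N -> 0 < opnorm N (invmx (1%:M - B n)).
  move=> /unit_n un; rewrite lt_neqAle opnorm_ge0// andbT eq_sym; apply/eqP => h.
  have := norm_le (invmx (1%:M - B n)); rewrite h mulr0 normr_le0 => /eqP i0.
  have := mulmxV un; rewrite i0 mulmx0 => /matrixP/(_ (Ordinal hd) (Ordinal hd))/eqP.
  by rewrite !mxE eqxx eq_sym oner_eq0.
have m2_fin n : (N0 <= n)%N -> m2 xi n \is a fin_num.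
  move=> nN; have nN1 := N1 _ nN; rewrite ge0_fin_numE ?(m2_ge0 hX)//.
  rewrite ltey; apply/eqP => m2y; have := fin1 _ (Nn1 _ nN).
  by rewrite /= m2y gt0_mulye ?lte_fin ?inv_gt0.
have mc : forall n i, (0 < n)%N -> 0 <= m n 0 i.
  by move=> n i n_gt0; apply: (bernoulli_ge0 (Z := eps n)) => A'; exact: hBe.
have BE n i l : (0 < n)%N -> B n i l = \int[P]_w (xi n 1%N i w 0 l)%:R.
  by move=> n_gt0; rewrite hB// mxE expectationE.
have Bc n i l : (0 < n)%N -> 0 <= B n i l.
  by move=> n_gt0; rewrite BE//; exact: Rintegral_ge0.
have prod0 j : mxprod B j n @[n --> \oo] --> (0 : 'M[R]_d).
  apply/norm_cvg0P.
  apply: (@squeeze_cvgr _ _ _ _ (fun=> 0) (fun n => c * opnorm N (mxprod B j n))).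
  - by apply: nearW => n; rewrite normr_ge0/=.
  - exact: cvg_cst.
  - by rewrite -(mulr0 c); apply: cvgM; [exact: cvg_cst|exact: B3].
have sumC n : \sum_(1 <= j < n.+1) `|(1%:M - B j) *m mxprod B j n| <= c * C0.
  apply: (@le_trans _ _ (c * \sum_(1 <= j < n.+1) opnorm N ((1%:M - B j) *m mxprod B j n))).
    by rewrite mulr_sumr; apply: ler_sum => j _.
  by rewrite ler_wpM2l//; apply: hC0; exists n.
have hKN j n : (N0 <= j)%N -> (j <= n)%N -> `|mxprod B j n| <= K by move=> /Nn0; exact: hK.
have lambda0 i : 0 <= lambda 0 i.
  exact: (limit_mean_ge0 unit_n prod0 sumC hM mc Bc).
apply: cvg_in_distribution_pgf => x x01; rewrite pgf_Po//.
(* u j n and r j n are the iterates and remainders of the recursion for the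
   distance to 1; cc j bounds the quadratic coefficient in generation j. *)
pose gap (y : 'rV[R]_d) : 'cV[R]_d := \col_i (1 - y 0 i).
pose y j n := backward (offspring_point xi) j n x.
have y01 j n : in_cube (y j n) by exact: backward_cube.
pose u j n := gap (y j n).
pose r j n : 'cV[R]_d := \col_i pgf_remainder P (xi j 1%N i) (y j n).
pose cc j := d%:R ^+ 2 * `|fine (m2 xi j)|.
have u_ge0 j n i : 0 <= u j n i 0 by rewrite mxE subr_ge0; case/andP: (y01 j n i).
have mu_prod j n : (0 < j)%N -> pgf P (eps j) (y j n) = 1 - (m j *m u j n) 0 0.
  move=> j0; rewrite (pgf_bernoulli (p := m j))// => [|A']; last exact: hBe.
  by rewrite mxE; congr (_ - _); apply: eq_bigr => i _; rewrite mxE.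
have -> : - \sum_(i < d) lambda 0 i * (1 - x 0 i) = - (lambda *m gap x) 0 0.
  by rewrite mxE; congr (- _); apply: eq_bigr => i _; rewrite mxE.
have E n : pgf P (X n) x = \prod_(1 <= j < n.+1) (1 - (m j *m u j n) 0 0).
  rewrite (gwi_pgf_prod hX)// !big_nat; apply: eq_bigr => j /andP[j0 _].
  exact: mu_prod.
rewrite (funext E).
apply: (@prod_pgf_cvg R d B m lambda N0 K (c * C0) B1 hKN unit_n prod0 sumC hM mc Bc
  (gap x) u r cc).
- by move=> n; rewrite /u /y backward_id.
- move=> j n jn; apply/colP => i; rewrite !mxE {1}/y backward_step// mxE /pgf_remainder.
  rewrite -/(y j.+1 n); under [in RHS]eq_bigr do rewrite BE// mxE.
  by rewrite subKr.
- by move=> j n i _; exact: u_ge0.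
- move=> j n i /andP[j0 _]; rewrite mxE; apply: pgf_remainder_ge0 => // l.
  exact: (offspring_fin hX).
- move=> j n /andP[j0 _]; rewrite -subr_ge0 -mu_prod//.
  by case/andP: (pgf_01 P (X := eps j) (measurable_funP _) (y01 j n)).
- by move=> j; rewrite mulr_ge0 ?exprn_ge0.
- move=> j n Nj /andP[j0 _]; apply: mx_norm_le => [|i k].
    by rewrite mulr_ge0 ?exprn_ge0// mulr_ge0 ?exprn_ge0.
  rewrite (ord1 k) mxE ger0_norm; last first.
    by apply: pgf_remainder_ge0 => // l; exact: (offspring_fin hX).
  apply: pgf_remainder_le => // [l|l|a l].
  + exact: (offspring_fin hX).
  + by have := ler_mx_entry (u j n) l 0; rewrite ger0_norm// mxE.
  + rewrite ger0_norm ?fine_ge0 ?(m2_ge0 hX)// fineK ?m2_fin//.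
    exact: (le_m2 hX).
- apply: (@squeeze_cvgr _ _ _ _ (fun=> 0) (fun n => d%:R ^+ 2 * c *
    fine (m2 xi n * (opnorm N (invmx (1%:M - B n)))%:E))).
  + near=> n; rewrite mulr_ge0 ?mulr_ge0 ?exprn_ge0//=.
    have nN : (N0 <= n)%N by near: n; exact: nbhs_infty_ge.
    have f0 : 0 <= fine (m2 xi n) by rewrite fine_ge0// (m2_ge0 hX hd (N1 _ nN)).
    rewrite fineM ?m2_fin//= /cc ger0_norm//.
    rewrite (_ : _ * c * _ = d%:R ^+ 2 * fine (m2 xi n) * (c * opnorm N (invmx (1%:M - B n)))); last by ring.
    by rewrite ler_wpM2l// mulr_ge0 ?exprn_ge0.
  + exact: cvg_cst.
  + by rewrite -(mulr0 (d%:R ^+ 2 * c)); apply: cvgM => //; exact: cvg_cst.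
Unshelve. all: by end_near. Qed.
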